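(* Let $G$ be a finitely generated discrete quantum group equipped with a word length function $l$, and assume that $G$ has property RD with respect to $l$; fix constants $c,s>0$ such that $\|a\|_{op}\le c\|a\|_{2,s}$ for all $a\in\mathbb{C}[G]$, where $\|\cdot\|_{2,s}$ is the Sobolev norm associated with $l$. Then for any positive integer $k>s$, the algebra $\mathbb{C}[G]\subset C^*_{\mathsf r}(G)$ together with the seminorm $L^k_T$ is a compact quantum metric space; that is, $L^k_T$ is a Lip-norm on the dense unital $*$-subalgebra $\mathbb{C}[G]$ of $C^*_{\mathsf r}(G)$.
   Context: Discrete quantum groups. A discrete quantum group $G$ is given by its reduced group $C^*$-algebra $C^*_{\mathsf r}(G)$ (the reduced unital Hopf $C^*$-algebra of the dual compact quantum group), with comultiplication $\hat\Delta$ and Haar state $\hat\phi$. $\mathrm{Irr}(G)$ is the set of equivalence classes of irreducible finite dimensional unitary corepresentations $X\in C^*_{\mathsf r}(G)\otimes\mathbb{L}(\mathcal{H})$, $(\hat\Delta\otimes\mathrm{id})(X)=X_{13}X_{23}$; $\epsilon$ is the trivial one, $\bar\alpha$ the conjugate of $\alpha$. $\mathbb{C}[G]\subset C^*_{\mathsf r}(G)$ is the dense Hopf $*$-algebra spanned by matrix coefficients, with antipode $S$. $l^2(G)$ is the GNS space of $\hat\phi$, with GNS map $\hat\Lambda$; $C^*_{\mathsf r}(G)$ acts on it by the regular (GNS) representation and $\|\cdot\|_{op}$ is the operator norm. For each $\alpha$ let $F^\alpha$ be the positive invertible matrix with $\mathrm{tr}(F^\alpha)=\mathrm{tr}((F^\alpha)^{-1})=\dim_q(\alpha)$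 given by the modular function $F=(F^\alpha)_\alpha$; fix orthonormal bases in which all $F^\alpha$ are diagonal, and let $u^\alpha_{ij}$ be the corresponding matrix coefficients, so that $\hat\phi((u^\alpha_{ij})^*u^\beta_{kl})=\delta_{\alpha\beta}\delta_{ik}\delta_{jl}(F^\alpha)^{-1}_{ii}/\dim_q(\alpha)$. $C_c(G)=\bigoplus_\alpha \mathbb{L}(\mathcal{H}_\alpha)$ (algebraic direct sum), $C(G)=\prod_\alpha\mathbb{L}(\mathcal{H}_\alpha)$, and $p_\alpha$ is the unit of the block $\alpha$. $C_c(G)$ and $\mathbb{C}[G]$ are in canonical duality; elements of one are viewed as functionals on the other. Length functions. A length function is $l:\mathrm{Irr}(G)\to[0,\infty)$ with $l(\epsilon)=0$, $l(\bar\alpha)=l(\alpha)$, and $l(\alpha)\le l(\beta)+l(\gamma)$ whenever $\alpha\subset\beta\otimes\gamma$. It gives $L=\sum_\alpha l(\alpha)p_\alpha\in C(G)$. $G$ is finitely generated if there is a finite $\mathcal{D}\subset\mathrm{Irr}(G)$ such that every $\alpha$ is contained in an iterated tensor product of elements of $\mathcal{D}$; a word length function is a length function of the form $l(\alpha)=$ the smallest $m$ such that $\alpha\subset\alpha_1\otimes\cdots\otimes\alpha_m$ with all $\alpha_j\in\mathcal{D}$ (with $l(\epsilon)=0$). Sobolev norms. The left Haar functional is $\phi(f)=\sum_\alpha\dim_q(\alpha)\mathrm{tr}(Fp_\alpha f)$ on $C_c(G)$, with $\langle f,g\rangle=\phi(f^*g)$. The Fourier transform $\mathcal{F}:C_c(G)\to\mathbb{C}[G]$,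 $\mathcal{F}(f)(h)=\phi(hf)$, is a linear isomorphism with inverse $\mathcal{F}^{-1}(x)(y)=\hat\phi(S(x)y)$. Put $C=\sum_\alpha\frac{\dim_q(\alpha)}{\dim(\alpha)}F^\alpha p_\alpha\in C(G)$. For $f\in C_c(G)$, $\|f\|_{2,s}^2=\langle(1+L)^sfC^{1/2},(1+L)^sfC^{1/2}\rangle$, and for $x\in\mathbb{C}[G]$, $\|x\|_{2,s}=\|\mathcal{F}^{-1}(x)\|_{2,s}$. $G$ has property RD with respect to $l$ if there are $c,s>0$ with $\|\mathcal{F}(f)\|_{op}\le c\|f\|_{2,s}$ for all $f\in C_c(G)$. The seminorm. $D$ is the self-adjoint operator on $l^2(G)$ with $D\hat\Lambda(u^\alpha_{ij})=l(\alpha)\hat\Lambda(u^\alpha_{ij})$. $C$ acts on $l^2(G)$ as the positive invertible (possibly unbounded) operator $C\hat\Lambda(u^\alpha_{ij})=\frac{\dim_q(\alpha)}{\dim(\alpha)}(F^\alpha)_{ii}\hat\Lambda(u^\alpha_{ij})$. For fixed $k$ put $T=C^{\frac{1}{2k}}$, $\delta_T(a)=[D,TaT]$, let $\delta_T^k$ be the $k$-fold iterate of $\delta_T$, and $L^k_T(a)=\|\delta_T^k(a)\|$ (operator norm on $l^2(G)$) for $a\in\mathbb{C}[G]$. Compact quantum metric spaces. Let $\mathcal{A}$ be a dense unital $*$-subalgebra of a unital $C^*$-algebra $A$. A Lipschitz seminorm on $\mathcal{A}$ is a seminorm $L:\mathcal{A}\to[0,\infty)$ with $L(a^* )=L(a)$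 and $L(a)=0$ iff $a\in\mathbb{C}1$. It is a Lip-norm if the topology on the state space $S(A)$ induced by $d_L(\mu,\nu)=\sup\{|\mu(a)-\nu(a)|: a\in\mathcal{A},\,L(a)\le1\}$ coincides with the $w^*$-topology. A unital $C^*$-algebra together with a Lip-norm on a dense $*$-subalgebra is a compact quantum metric space.
   Formalization: The formal theorem additionally assumes that δ_T^k(a) is bounded for every a in C[G], so that L^k_T takes values in [0,∞); this can fail when C is unbounded, e.g. for the dual of SU_q(2), which has property RD. *)

(* Defs.v *)
From HB Require Import structures.
From mathcomp Require Import all_boot all_order all_algebra.
From mathcomp Require Import complex mxtens.
From mathcomp Require Import finmap.
From mathcomp Require Import boolp classical_sets functions cardinality fsbigop.
From mathcomp Require Import reals constructive_ereal ereal exp.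

Set Implicit Arguments.
Unset Strict Implicit.
Unset Printing Implicit Defensive.
Import Order.TTheory GRing.Theory Num.Theory ComplexField.Normc.
Local Open Scope classical_set_scope.
Local Open Scope ring_scope.
Local Open Scope complex_scope.

Record cstarAlgebra (R : realType) := CstarAlgebra {
  cstar_car :> algType R[i];
  star : cstar_car -> cstar_car;
  cnorm : cstar_car -> R;
  starK : forall a, star (star a) = a;
  starD : forall a b, star (a + b) = star a + star b;
  starZ : forall (z : R[i]) a, star (z *: a) = z^* *: star a;
  starM : forall a b, star (a * b) = star b * star a;
  cnorm_eq0 : forall a, cnorm a = 0 -> a = 0;
  cnormD : forall a b, cnorm (a + b) <= cnorm a + cnorm b;
  cnormZ : forall (z : R[i]) a, cnorm (z *: a) = normc z * cnorm a;
  cnormM : forall a b, cnorm (a * b) <= cnorm a * cnorm b;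
  cnorm_star : forall a, cnorm (star a * a) = cnorm a ^+ 2;
  cnorm_complete : forall x : nat -> cstar_car,
    (forall e : R, 0 < e -> exists N, forall m n,
       (N <= m)%N -> (N <= n)%N -> cnorm (x m - x n) < e) ->
    exists y, forall e : R, 0 < e -> exists N, forall n,
       (N <= n)%N -> cnorm (x n - y) < e
}.

Section CstarTheory.
Variables (R : realType) (A : cstarAlgebra R).
Implicit Types (V : set A) (a b x : A) (mu nu omega : {scalar A}).

Definition lspan (X : set A) : set A :=
  [set a | exists n (z : 'I_n -> R[i]) (x : 'I_n -> A),
     (forall i, X (x i)) /\ a = \sum_i z i *: x i].

Definition norm_dense V : Prop :=
  forall a (e : R), 0 < e -> exists2 v, V v & cnorm (a - v) < e.

Definition dense_star_subalgebra V : Prop :=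
  [/\ V 1,
      forall (z : R[i]) a b, V a -> V b -> V (z *: a + b),
      forall a b, V a -> V b -> V (a * b),
      forall a, V a -> V (star a)
    & norm_dense V].

(* positive linear functionals of norm one *)
Definition is_state mu : Prop :=
  [/\ forall a, 0 <= mu (star a * a),
      forall a, normc (mu a) <= cnorm a
    & mu 1 = 1].

(* norm of Lambda(x) in the GNS space of omega *)
Definition l2norm omega x : R := Num.sqrt (complex.Re (omega (star x * x))).

(* [opnorm V omega X] is the operator norm on the GNS space of omega of the
   operator Lambda(x) |-> Lambda(X x), where Lambda(V) is a dense subspace
   preserved by X; it is +oo if the operator is unbounded. *)
Definition opnorm V omega (X : A -> A) : \bar R :=
  ereal_sup [set (l2norm omega (X x))%:E | x in
               [set x | V x /\ l2norm omega x <= 1]].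

Definition gns_isometric V omega : Prop :=
  forall a, (cnorm a)%:E = opnorm V omega (fun x => a * x).

Definition lipschitz_seminorm V (L : A -> R) : Prop :=
  (forall a, V a -> 0 <= L a) /\
  [/\ forall a b, V a -> V b -> L (a + b) <= L a + L b,
      forall (z : R[i]) a, V a -> L (z *: a) = normc z * L a,
      forall a, V a -> L (star a) = L a
    & forall a, V a -> (L a = 0 <-> exists z : R[i], a = z%:A)].

Definition lip_dist V (L : A -> R) mu nu : \bar R :=
  ereal_sup [set (normc (mu a - nu a))%:E | a in [set a | V a /\ L a <= 1]].

Definition lip_dist_open V L (U : set {scalar A}) : Prop :=
  forall mu, U mu -> exists2 e : R, 0 < e &
    forall nu, is_state nu -> (lip_dist V L mu nu < e%:E)%E -> U nu.

Definition wstar_open (U : set {scalar A}) : Prop :=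
  forall mu, U mu -> exists2 e : R, 0 < e & exists F : seq A,
    forall nu, is_state nu ->
      (forall a, a \in F -> normc (mu a - nu a) < e) -> U nu.

Definition lip_norm V L : Prop :=
  lipschitz_seminorm V L /\
  forall U : set {scalar A}, (forall mu, U mu -> is_state mu) ->
    (lip_dist_open V L U <-> wstar_open U).

Definition compact_quantum_metric_space V L : Prop :=
  dense_star_subalgebra V /\ lip_norm V L.

End CstarTheory.

(* A unital C*-algebra [cqg_alg] with a comultiplication into [cqg_alg2], which
   contains two commuting copies (a |-> a (x) 1 and a |-> 1 (x) a) of
   [cqg_alg]; that [cqg_alg2] is their spatial tensor product is part of
   [discreteQG]. Coassociativity is automatic there, since the matrix
   coefficients of corepresentations are dense. *)
Record comultiplication (R : realType) := Comultiplication {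
  cqg_alg :> cstarAlgebra R;
  cqg_alg2 : cstarAlgebra R;
  leg1 : {lrmorphism cqg_alg -> cqg_alg2};
  leg2 : {lrmorphism cqg_alg -> cqg_alg2};
  comult : {lrmorphism cqg_alg -> cqg_alg2};
  leg1_star : forall a, leg1 (star a) = star (leg1 a);
  leg2_star : forall a, leg2 (star a) = star (leg2 a);
  comult_star : forall a, comult (star a) = star (comult a);
  legC : forall a b, leg1 a * leg2 b = leg2 b * leg1 a
}.

Section Corepresentations.
Variables (R : realType) (A : comultiplication R).

Definition scalar_mx_in m n (T : 'M[R[i]]_(m, n)) : 'M[A]_(m, n) :=
  map_mx (in_alg A) T.

Definition star_mx m n (v : 'M[A]_(m, n)) : 'M[A]_(m, n) :=
  map_mx (@star R A) v.

(* v = sum_ij v_ij (x) e_ij, so that (comult (x) id)(v) = v_13 v_23 *)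
Definition unitary_corep n (v : 'M[A]_n) : Prop :=
  [/\ forall i j, comult A (v i j) = \sum_k leg1 A (v i k) * leg2 A (v k j),
      v *m (star_mx v)^T = 1%:M
    & (star_mx v)^T *m v = 1%:M].

Definition intertwiner m n (v : 'M[A]_m) (w : 'M[A]_n) (T : 'M[R[i]]_(m, n)) :=
  v *m scalar_mx_in T = scalar_mx_in T *m w.

Definition irreducible_corep n (v : 'M[A]_n) : Prop :=
  (0 < n)%N /\ forall T, intertwiner v v T -> is_scalar_mx T.

Definition equivalent_corep m n (v : 'M[A]_m) (w : 'M[A]_n) : Prop :=
  exists T T', [/\ T *m T' = 1%:M, T' *m T = 1%:M & intertwiner v w T].

(* w is contained in v *)
Definition subcorep m n (w : 'M[A]_n) (v : 'M[A]_m) : Prop :=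
  exists T T', T' *m T = 1%:M /\ intertwiner v w T.

End Corepresentations.

Record discreteQG (R : realType) := DiscreteQG {
  redC :> comultiplication R;
  haar : {scalar redC};
  haar2 : {scalar (cqg_alg2 redC)};
  Irr : choiceType;
  dim : Irr -> nat;
  u : forall alpha : Irr, 'M[redC]_(dim alpha);
  modF : forall alpha : Irr, 'I_(dim alpha) -> R;

  irr_corep : forall alpha, unitary_corep (u alpha);
  irr_irreducible : forall alpha, irreducible_corep (u alpha);
  irr_inj : forall alpha beta,
    equivalent_corep (u alpha) (u beta) -> alpha = beta;
  irr_surj : forall n (v : 'M[redC]_n), unitary_corep v ->
    irreducible_corep v -> exists alpha, equivalent_corep (u alpha) v;

  CG : set redC := lspan [set a | exists alpha i j, a = u alpha i j];
  CG2 : set (cqg_alg2 redC) :=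
    lspan [set a | exists x y, [/\ CG x, CG y & a = leg1 _ x * leg2 _ y]];
  CG_dense : dense_star_subalgebra CG;
  CG2_dense : norm_dense CG2;

  haar_state : is_state haar;
  haar_left : forall alpha (i j : 'I_(dim alpha)),
    \sum_k haar (u alpha k j) *: u alpha i k = (haar (u alpha i j))%:A;
  haar_right : forall alpha (i j : 'I_(dim alpha)),
    \sum_k haar (u alpha i k) *: u alpha k j = (haar (u alpha i j))%:A;
  haar2_state : is_state haar2;
  haar2E : forall a b, haar2 (leg1 _ a * leg2 _ b) = haar a * haar b;
  (* reducedness: the regular representation on l^2(G) is isometric; and
     [cqg_alg2] is the spatial tensor product, acting on l^2(G) (x) l^2(G) *)
  haar_isometric : gns_isometric CG haar;
  haar2_isometric : gns_isometric CG2 haar2;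

  (* [modF alpha] is the diagonal of F^alpha, which is determined by these
     conditions *)
  modF_gt0 : forall alpha i, 0 < @modF alpha i;
  modF_tr : forall alpha,
    \sum_i @modF alpha i = \sum_i (@modF alpha i)^-1;
  haar_orth : forall alpha (i j k l : 'I_(dim alpha)),
    haar (star (u alpha i j) * u alpha k l) =
    (((i == k) && (j == l))%:R * (@modF alpha i)^-1
       / \sum_m @modF alpha m)%:C;
  haar_orth_neq : forall alpha beta i j k l, alpha != beta ->
    haar (star (u alpha i j) * u beta k l) = 0
}.

Arguments CG {R}.

Section DiscreteQuantumGroups.
Variables (R : realType) (G : discreteQG R).
Implicit Types (a x : G) (alpha beta gamma : Irr G) (l : Irr G -> R).

Definition dimq alpha : R := \sum_i modF (alpha := alpha) i.

Fixpoint word_dim (w : seq (Irr G)) : nat :=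
  if w is alpha :: w' then (dim alpha * word_dim w')%N else 1%N.

Fixpoint word_corep (w : seq (Irr G)) : 'M[G]_(word_dim w) :=
  match w with
  | [::] => 1%:M
  | alpha :: w' => tensmx (u alpha) (word_corep w')
  end.

Definition conjugate_irr alpha beta : Prop :=
  equivalent_corep (star_mx (u alpha)) (u beta).

Definition trivial_irr alpha : Prop :=
  equivalent_corep (u alpha) (1%:M : 'M[G]_1).

Definition length_function l : Prop :=
  [/\ forall alpha, 0 <= l alpha,
      forall alpha, trivial_irr alpha -> l alpha = 0,
      forall alpha beta, conjugate_irr alpha beta -> l beta = l alpha
    & forall alpha beta gamma,
        subcorep (u alpha) (tensmx (u beta) (u gamma)) ->
        l alpha <= l beta + l gamma].

Definition generating (D : seq (Irr G)) : Prop :=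
  forall alpha, exists2 w : seq (Irr G),
    {subset w <= D} & subcorep (u alpha) (word_corep w).

Definition finitely_generated : Prop := exists D, generating D.

Definition word_length_function l : Prop :=
  length_function l /\
  exists2 D : seq (Irr G), generating D &
    forall alpha, exists m : nat, l alpha = m%:R /\
      (exists w : seq (Irr G), [/\ size w = m, {subset w <= D}
         & subcorep (u alpha) (word_corep w)]) /\
      (forall w : seq (Irr G), {subset w <= D} ->
         subcorep (u alpha) (word_corep w) -> (m <= size w)%N).

(* coefficient of x in C[G] on u^alpha_ij *)
Definition coef alpha i j x : R[i] :=
  (dimq alpha * modF i)%:C * haar G (star (u alpha i j) * x).

Definition antipode x : G :=
  \sum_(alpha \in [set: Irr G]) \sum_i \sum_j
     coef i j x *: star (u alpha j i).

(* C(G); C_c(G) consists of the finitely supported elements. *)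
Definition CofG := forall alpha, 'M[R[i]]_(dim alpha).

Definition CcG (f : CofG) : Prop := finite_set [set alpha | f alpha != 0].

(* Duality between C_c(G) and C[G]: the matrix unit e_ji is dual to u_ij. This
   is the convention (product of C_c(G) opposite to convolution) for which
   F(f)(h) = phi(hf) and F^-1(x)(y) = haar(S(x)y) are inverse to each other,
   see [fourierK] and [fourier_invK]. *)
Definition pairing (h : CofG) x : R[i] :=
  \sum_(alpha \in [set: Irr G]) \sum_i \sum_j h alpha j i * coef i j x.

Definition Fmx alpha : 'M[R[i]]_(dim alpha) :=
  diag_mx (\row_i (modF i)%:C).

Definition phi_block alpha (m : 'M[R[i]]_(dim alpha)) : R[i] :=
  (dimq alpha)%:C * \tr (Fmx alpha *m m).

Definition phi (f : CofG) : R[i] :=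
  \sum_(alpha \in [set: Irr G]) phi_block (f alpha).

(* the coefficient on u_ij is phi(e_ji f) *)
Definition fourier (f : CofG) : G :=
  \sum_(alpha \in [set: Irr G]) \sum_i \sum_j
     phi_block (delta_mx j i *m f alpha) *: u alpha i j.

(* the functional y |-> haar(S(x)y) *)
Definition fourier_inv x : CofG :=
  fun alpha => \matrix_(j, i) haar G (antipode x * u alpha i j).

Definition Cdiag alpha (i : 'I_(dim alpha)) : R :=
  dimq alpha / (dim alpha)%:R * modF i.

Definition Csqrt alpha : 'M[R[i]]_(dim alpha) :=
  diag_mx (\row_i (Num.sqrt (Cdiag i))%:C).

Definition sobolev_norm_fun l (s : R) (f : CofG) : R :=
  let g : CofG :=
    fun alpha => ((1 + l alpha) `^ s)%:C *: (f alpha *m Csqrt alpha) in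
  Num.sqrt (complex.Re
    (phi (fun alpha => (map_mx (@conjc R) (g alpha))^T *m g alpha))).

Definition sobolev_norm l (s : R) x : R := sobolev_norm_fun l s (fourier_inv x).

(* operator norm of x in the regular representation on l^2(G) *)
Definition regular_norm x : \bar R := opnorm (CG G) (haar G) (fun y => x * y).

Definition property_RD l : Prop :=
  exists c s : R, [/\ 0 < c, 0 < s &
    forall f, CcG f ->
      (regular_norm (fourier f) <= (c * sobolev_norm_fun l s f)%:E)%E].

(* Operators on l^2(G) are given by their restriction to the dense subspace
   Lambda(C[G]), identified with C[G]. [diag_op d] is the diagonal operator
   with Lambda(u_ij) |-> d alpha i * Lambda(u_ij). *)
Definition diag_op (d : forall alpha, 'I_(dim alpha) -> R) x : G :=
  \sum_(alpha \in [set: Irr G]) \sum_i \sum_j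
     ((@d alpha i)%:C * coef i j x) *: u alpha i j.

Definition Dop l : G -> G := diag_op (fun alpha _ => l alpha).

Definition Top (k : nat) : G -> G :=
  diag_op (fun alpha i => Cdiag i `^ ((2 * k)%:R)^-1).

(* X |-> [D, T X T] with T = C^(1/2k) *)
Definition delta_T l k (X : G -> G) : G -> G :=
  fun x => Dop l (Top k (X (Top k x))) - Top k (X (Top k (Dop l x))).

Definition LkT l (k : nat) a : \bar R :=
  opnorm (CG G) (haar G) (iter k (delta_T l k) (fun x => a * x)).

(* L : C[G] -> [0, oo[ is the seminorm a |-> ||delta_T^k(a)||. As this norm is
   the value of the real-valued L, the operators delta_T^k(a), a in C[G],
   are bounded; this is automatic if F = 1 but not for general F. *)
Definition is_LkT l (k : nat) (L : G -> R) : Prop :=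
  forall a, CG G a -> (L a)%:E = LkT l k a.

End DiscreteQuantumGroups.

Section FourierInversion.
Variables (R : realType) (G : discreteQG R).
Implicit Types (x : G) (alpha beta : Irr G) (f h : CofG G).

Lemma fsum_single (V : nmodType) (E : Irr G -> V) alpha :
  (forall beta, beta != alpha -> E beta = 0) ->
  \sum_(beta \in [set: Irr G]) E beta = E alpha.
Proof.
move=> E0; rewrite -(fsbig_widen [set alpha] [set: Irr G]) ?fsbig_set1//.
by move=> beta /= [_ /eqP]; exact: E0.
Qed.

Lemma dimq_gt0 alpha : (0 < dim alpha)%N -> 0 < dimq alpha.
Proof.
move=> d0; rewrite /dimq (bigD1 (Ordinal d0)) //=.
rewrite ltr_wpDr ?modF_gt0// sumr_ge0// => i _; exact: ltW (modF_gt0 _).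
Qed.

Lemma dimq_modF_neq0 alpha (i : 'I_(dim alpha)) : dimq alpha * modF i != 0.
Proof.
apply: lt0r_neq0; rewrite mulr_gt0 ?modF_gt0// dimq_gt0//.
exact: leq_ltn_trans (leq0n i) (ltn_ord i).
Qed.

Fact coef_is_linear alpha (i j : 'I_(dim alpha)) :
  linear_for *%R (coef i j : G -> R[i]).
Proof.
by move=> z x y; rewrite /coef mulrDr -scalerAr linearP mulrDr mulrCA.
Qed.

HB.instance Definition _ alpha (i j : 'I_(dim alpha)) :=
  GRing.isLinear.Build R[i] G R[i] *%R (coef i j) (coef_is_linear i j).

Lemma coef_u alpha (i j k l : 'I_(dim alpha)) :
  coef i j (u alpha k l) = ((i == k) && (j == l))%:R.
Proof.
rewrite /coef haar_orth -rmorphM /= -/(dimq alpha).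
case: (_ && _); last by rewrite !mul0r !mulr0 rmorph0.
by rewrite mul1r -invfM [modF i * _]mulrC mulfV ?dimq_modF_neq0 ?rmorph1.
Qed.

Lemma coef_u_neq alpha beta (i j : 'I_(dim alpha)) k l : alpha != beta ->
  coef i j (u beta k l) = 0.
Proof. by move=> ab; rewrite /coef haar_orth_neq// mulr0. Qed.

Lemma CG_expand x : CG G x -> exists A : {fset Irr G},
  (forall alpha i j, alpha \notin A -> @coef R G alpha i j x = 0) /\
  x = \sum_(alpha <- A) \sum_i \sum_j coef i j x *: u alpha i j.
Proof.
case=> n [z [y [yu ->]]].
have /choice [al al_y] : forall m, exists alpha, exists i j, y m = u alpha i j.
  by move=> m; case: (yu m) => alpha [i [j ->]]; exists alpha, i, j.
exists (seq_fset tt [seq al m | m <- enum 'I_n]); split=> [alpha i j|].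
  rewrite seq_fsetE => aln; rewrite linear_sum big1// => m _.
  rewrite linearZ /=; have [k [l ->]] := al_y m.
  rewrite coef_u_neq ?mulr0//; apply: contra aln => /eqP ->.
  by apply: map_f; rewrite mem_enum.
rewrite [RHS](_ : _ = \sum_(m < n) z m *: \sum_(alpha <- seq_fset tt
  [seq al m | m <- enum 'I_n]) \sum_i \sum_j coef i j (y m) *: u alpha i j).
  apply: eq_bigr => m _; congr (_ *: _).
  have [k [l yE]] := al_y m.
  have mA : al m \in seq_fset tt [seq al m | m <- enum 'I_n].
    by rewrite seq_fsetE; apply: map_f; rewrite mem_enum.
  rewrite (bigD1_seq (al m) mA (fset_uniq _)) /=.
  rewrite [X in _ + X]big1 ?addr0 => [|beta bm]; last first.
    by rewrite big1// => i _; rewrite big1// => j _; rewrite yE coef_u_neq ?scale0r.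
  rewrite (bigD1 k)//= (bigD1 l)//= yE coef_u !eqxx scale1r.
  rewrite big1 ?addr0 => [|j jl]; last by rewrite coef_u (negPf jl) andbF scale0r.
  rewrite big1 ?addr0// => i ik.
  by rewrite big1// => j _; rewrite coef_u (negPf ik) scale0r.
under [RHS]eq_bigr do rewrite scaler_sumr.
rewrite [RHS]exchange_big /=; apply: eq_bigr => alpha _.
under [RHS]eq_bigr do rewrite scaler_sumr.
rewrite [RHS]exchange_big /=; apply: eq_bigr => i _.
under [RHS]eq_bigr do rewrite scaler_sumr.
rewrite [RHS]exchange_big /=; apply: eq_bigr => j _.
rewrite linear_sum scaler_suml; apply: eq_bigr => m _.
by rewrite linearZ /= scalerA.
Qed.

Lemma phi_block_delta f alpha i j :
  phi_block (delta_mx j i *m f alpha) = (dimq alpha * modF j)%:C * f alpha i j.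
Proof.
rewrite /phi_block rmorphM /= -mulrA; congr (_ * _).
rewrite /mxtrace (bigD1 j)//= big1 ?addr0 => [|k kj]; last first.
  rewrite mul_diag_mx !mxE big1 ?mulr0// => m _.
  by rewrite !mxE (negPf kj) mul0r.
rewrite mul_diag_mx !mxE (bigD1 i)//= !mxE !eqxx mul1r big1 ?addr0// => m mi.
by rewrite !mxE (negPf mi) andbF mul0r.
Qed.

Lemma fourier_fsetE f (A : {fset Irr G}) :
  (forall alpha, alpha \notin A -> f alpha = 0) ->
  fourier f = \sum_(alpha <- A) \sum_i \sum_j
     phi_block (delta_mx j i *m f alpha) *: u alpha i j.
Proof.
move=> fA; rewrite /fourier (fsbigTE A)// => alpha /fA f0.
by rewrite big1// => i _; rewrite big1// => j _;
  rewrite phi_block_delta f0 mxE mulr0 scale0r.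
Qed.

Lemma CcG_fset f : CcG f -> exists A : {fset Irr G},
  forall alpha, alpha \notin A -> f alpha = 0.
Proof.
move=> ff; exists (fset_set [set alpha | f alpha != 0]) => alpha.
by rewrite in_fset_set// notin_setE /= => /negP; rewrite negbK => /eqP.
Qed.

Lemma coef_fourier f alpha (i j : 'I_(dim alpha)) : CcG f ->
  coef i j (fourier f) = (dimq alpha * modF j)%:C * f alpha i j.
Proof.
case/CcG_fset=> A fA; rewrite (fourier_fsetE fA) linear_sum /=.
have coefE beta : coef i j (\sum_k \sum_l
    phi_block (delta_mx l k *m f beta) *: u beta k l) =
  \sum_k \sum_l phi_block (delta_mx l k *m f beta) * coef i j (u beta k l).
  rewrite linear_sum; apply: eq_bigr => k _; rewrite linear_sum.
  by apply: eq_bigr => l _; rewrite linearZ.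
have coef0 beta : beta != alpha -> coef i j (\sum_k \sum_l
    phi_block (delta_mx l k *m f beta) *: u beta k l) = 0.
  move=> ba; rewrite coefE big1// => k _; rewrite big1// => l _.
  by rewrite coef_u_neq ?mulr0// eq_sym.
have [aA|aA] := boolP (alpha \in A); last first.
  rewrite fA// mxE mulr0 big_seq big1// => beta bA; apply: coef0.
  by apply: contraNneq aA => <-.
rewrite (bigD1_seq alpha) ?fset_uniq//= [X in _ + X]big1 ?addr0//.
rewrite coefE (bigD1 i)//= (bigD1 j)//= coef_u !eqxx mulr1 phi_block_delta.
rewrite big1 ?addr0 => [|l lj]; last first.
  by rewrite coef_u [j == l]eq_sym (negPf lj) andbF mulr0.
rewrite big1 ?addr0// => k ki; rewrite big1// => l _.
by rewrite coef_u [i == k]eq_sym (negPf ki) mulr0.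
Qed.

Lemma CG_fourier f : CcG f -> CG G (fourier f).
Proof.
case/CcG_fset=> A fA; rewrite (fourier_fsetE fA).
have [_ CGl _ _ _] := CG_dense G.
have CG0 : CG G 0 by exists 0%N, (fun=> 0), (fun=> 0); split=> [[]|]//;
  rewrite big_ord0.
have CGD x y : CG G x -> CG G y -> CG G (x + y).
  by move=> Cx Cy; rewrite -[x]scale1r; exact: CGl.
apply: big_ind => // alpha _; apply: big_ind => // i _.
apply: big_ind => // j _; rewrite -[X in CG G X]addr0; apply: CGl => //.
exists 1%N, (fun=> 1), (fun=> u alpha i j); split; first by exists alpha, i, j.
by rewrite big_ord1 scale1r.
Qed.

Lemma fourier_invE x alpha (i j : 'I_(dim alpha)) : CG G x ->
  fourier_inv x alpha i j = coef i j x / (dimq alpha * modF j)%:C.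
Proof.
move=> /CG_expand[A [xA _]]; rewrite mxE /antipode (fsbigTE A); last first.
  move=> beta bA; rewrite big1// => k _; rewrite big1// => l _.
  by rewrite xA// scale0r.
rewrite mulr_suml linear_sum /=.
have haarE beta : haar G ((\sum_k \sum_l coef k l x *: star (u beta l k))
      * u alpha j i) =
    \sum_k \sum_l coef k l x * haar G (star (u beta l k) * u alpha j i).
  rewrite mulr_suml linear_sum; apply: eq_bigr => k _.
  rewrite mulr_suml linear_sum; apply: eq_bigr => l _.
  by rewrite -scalerAl linearZ.
have haar0 beta : beta != alpha -> haar G ((\sum_k \sum_l
    coef k l x *: star (u beta l k)) * u alpha j i) = 0.
  move=> ba; rewrite haarE big1// => k _; rewrite big1// => l _.
  by rewrite haar_orth_neq ?mulr0.
have [aA|aA] := boolP (alpha \in A); last first.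
  rewrite xA// mul0r big_seq big1// => beta bA; apply: haar0.
  by apply: contraNneq aA => <-.
rewrite (bigD1_seq alpha) ?fset_uniq//= [X in _ + X]big1 ?addr0//.
rewrite haarE (bigD1 i)//= (bigD1 j)//= haar_orth !eqxx mul1r -/(dimq alpha).
rewrite big1 ?addr0 => [|l lj]; last first.
  by rewrite haar_orth (negPf lj) !mul0r rmorph0 mulr0.
rewrite big1 ?addr0 => [|k ki]; last first.
  by rewrite big1// => l _; rewrite haar_orth (negPf ki) andbF !mul0r rmorph0 mulr0.
by rewrite -invfM fmorphV [modF j * _]mulrC.
Qed.

Lemma CcG_fourier_inv x : CG G x -> CcG (fourier_inv x).
Proof.
move=> Cx; have [A [xA _]] := CG_expand Cx.
apply: (@sub_finite_set _ _ [set` A]) => // alpha /=; apply: contra_neqT => aA.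
by apply/matrixP => i j; rewrite fourier_invE// xA// mul0r mxE.
Qed.

Lemma fourierK f : CcG f -> fourier_inv (fourier f) = f.
Proof.
move=> ff; apply: functional_extensionality_dep => alpha; apply/matrixP => i j.
rewrite fourier_invE; last exact: CG_fourier.
rewrite coef_fourier// mulrC mulKf// (inj_eq (@complexI _)).
exact: dimq_modF_neq0.
Qed.

Lemma fourier_invK x : CG G x -> fourier (fourier_inv x) = x.
Proof.
move=> Cx; have [A [xA xE]] := CG_expand Cx.
have fA alpha : alpha \notin A -> fourier_inv x alpha = 0.
  by move=> aA; apply/matrixP => i j; rewrite fourier_invE// xA// mul0r mxE.
rewrite (fourier_fsetE fA) [RHS]xE; apply: eq_bigr => alpha _.
apply: eq_bigr => i _; apply: eq_bigr => j _; congr (_ *: _).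
rewrite phi_block_delta fourier_invE// mulrC divfK// (inj_eq (@complexI _)).
exact: dimq_modF_neq0.
Qed.

Lemma pairing_fourier h f : CcG f ->
  pairing h (fourier f) = phi (fun alpha => h alpha *m f alpha).
Proof.
move=> ff; rewrite /pairing /phi; apply: eq_fsbigr => alpha _.
rewrite /phi_block mulr_sumr exchange_big /=; apply: eq_bigr => j _.
rewrite mul_diag_mx !mxE !mulr_sumr; apply: eq_bigr => i _.
by rewrite coef_fourier// rmorphM /= mulrA [h _ _ _ * _]mulrC -!mulrA; congr (_ * (_ * _)).
Qed.

Lemma pairing_fourier_inv x alpha (i j : 'I_(dim alpha)) :
  CG G x -> pairing (fourier_inv x) (u alpha i j) =
    haar G (antipode x * u alpha i j).
Proof.
move=> Cx; rewrite /pairing (@fsum_single _ _ alpha); last first.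
  move=> beta ba; rewrite big1// => k _; rewrite big1// => l _.
  by rewrite coef_u_neq// mulr0.
rewrite (bigD1 i)//= (bigD1 j)//= coef_u !eqxx mulr1 mxE.
rewrite big1 ?addr0 => [|l lj]; last by rewrite coef_u (negPf lj) andbF mulr0.
rewrite big1 ?addr0// => k ki.
by rewrite big1// => l _; rewrite coef_u (negPf ki) mulr0.
Qed.

End FourierInversion.

(* Main.v *)
Require Import Defs.
From mathcomp Require Import all_boot all_order all_algebra.
From mathcomp Require Import complex reals constructive_ereal.
From mathcomp Require Import mxtens finmap boolp classical_sets functions.
From mathcomp Require Import cardinality fsbigop ereal exp ring lra.
(* [dim] and [u] of [Defs] must shadow the names from [all_algebra]. *)
Import Defs.

(**
  Since [D 1 = 0] and [T 1 = t 1] with [t > 0], one has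
  [delta_T^k(a) 1 = t^k (D T)^k a], and because [T^{2k} = C] the squared norm
  of [(D T)^k a] is [sum l(alpha)^{2k} |a_alpha|^2 / dim(alpha)], whereas
  [||a||_{2,s}^2 = sum (1 + l(alpha))^{2s} |a_alpha|^2 / dim(alpha)].
  The norm on the left is at most [L a], so [L a = 0] kills every block with
  [l(alpha) <> 0] and leaves a scalar.  As [k > s], property RD makes the
  operator norm of the part of [a] supported on [{l >= n}] tend to 0 uniformly
  on [{L <= 1}].  The ball [{l < n}] is finite, so up to a uniformly small error
  two states are compared on finitely many matrix coefficients, with bounded
  weights: weak-* closeness implies closeness for [d_L].  The converse only uses
  the density of [C[G]].  [L] is invariant under the involution because the
  adjoint of [delta_T^k(a)] is [(-1)^k delta_T^k(star a)].
*)

Set Implicit Arguments.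
Unset Strict Implicit.
Unset Printing Implicit Defensive.
Import Order.TTheory GRing.Theory Num.Theory ComplexField.Normc.
Local Open Scope ring_scope.
Local Open Scope complex_scope.

(** * States on a C*-algebra *)

Section StarAlgebra.
Variables (R : realType) (A : cstarAlgebra R).
Implicit Types (a b : A).

Lemma star0 : star (0 : A) = 0.
Proof. by apply: (addrI (star 0)); rewrite -starD !addr0. Qed.

Lemma starN a : star (- a) = - star a.
Proof. by apply: (addrI (star a)); rewrite -starD !subrr star0. Qed.

Lemma starB a b : star (a - b) = star a - star b.
Proof. by rewrite starD starN. Qed.

Lemma star1 : star (1 : A) = 1.
Proof. by rewrite -[LHS]mulr1 -[X in _ * X]starK -starM mulr1 starK. Qed.

End StarAlgebra.

(** * Arithmetic of real parts and moduli of complex numbers *)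

Lemma normc_sqr (R : rcfType) (z : R[i]) :
  normc z ^+ 2 = complex.Re z ^+ 2 + complex.Im z ^+ 2.
Proof. by case: z => a b /=; rewrite sqr_sqrtr// addr_ge0// sqr_ge0. Qed.

Lemma normc_ge0 (R : rcfType) (z : R[i]) : 0 <= normc z.
Proof. by case: z => a b; exact: sqrtr_ge0. Qed.

Lemma conjcM_normc (R : rcfType) (z : R[i]) : Num.conj z * z = (normc z ^+ 2)%:C.
Proof.
rewrite normc_sqr; case: z => a b; apply/eqP; rewrite eq_complex /=.
by apply/andP; split; apply/eqP; ring.
Qed.

Lemma conjC_real (R : rcfType) (r : R) : Num.conj r%:C = r%:C.
Proof. exact: conjc_real. Qed.

Lemma conjC_realM (R : rcfType) (r : R) (z : R[i]) :
  Num.conj (r%:C * z) = r%:C * Num.conj z.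
Proof. by rewrite rmorphM /= [X in X * _](@conjc_real R r). Qed.

Lemma normc_real (R : rcfType) (r : R) : normc r%:C = `|r|.
Proof. by rewrite /= expr0n addr0 sqrtr_sqr. Qed.

Lemma ReM_real (R : rcfType) (r : R) (z : R[i]) :
  complex.Re (r%:C * z) = r * complex.Re z.
Proof. by case: z => a b /=; rewrite mul0r subr0. Qed.

Lemma ReD (R : rcfType) (y z : R[i]) :
  complex.Re (y + z) = complex.Re y + complex.Re z.
Proof. by case: y z => a b [c d]. Qed.

Lemma ReN (R : rcfType) (z : R[i]) : complex.Re (- z) = - complex.Re z.
Proof. by case: z. Qed.

Lemma Re_sum (R : rcfType) (I : Type) (r : seq I) (F : I -> R[i]) :
  complex.Re (\sum_(i <- r) F i) = \sum_(i <- r) complex.Re (F i).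
Proof. by elim/big_rec2: _ => [|i a b _ <-] //; rewrite ReD. Qed.

Lemma real_complex_sum (R : rcfType) (I : Type) (r : seq I) (F : I -> R) :
  (\sum_(i <- r) F i)%:C = \sum_(i <- r) (F i)%:C :> R[i].
Proof. exact: rmorph_sum. Qed.

Lemma normcD (R : rcfType) (y z : R[i]) : normc (y + z) <= normc y + normc z.
Proof. exact: le_normcD. Qed.

Lemma normc_sum (R : rcfType) (I : Type) (r : seq I) (F : I -> R[i]) :
  normc (\sum_(i <- r) F i) <= \sum_(i <- r) normc (F i).
Proof.
elim/big_rec2: _ => [|i y z _ le_zy]; first by rewrite normc0.
by apply: le_trans (normcD _ _) _; rewrite lerD2l.
Qed.

Section States.
Variables (R : realType) (A : cstarAlgebra R) (omega : {scalar A}).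
Hypothesis omega_state : is_state omega.
Implicit Types (a x y : A) (V : set A) (X : A -> A).
Let l2 := l2norm omega.

Lemma state_sqr_real x :
  complex.Im (omega (star x * x)) = 0 /\ 0 <= complex.Re (omega (star x * x)).
Proof.
have [pos _ _] := omega_state; have := pos x.
by rewrite lecE /= => /andP[/eqP]; split.
Qed.

(** Polarisation: the value of [omega] at the square of [1 + z *: x] is real. Taking [z = 1]
    compares the imaginary parts of [omega x] and [omega (star x)], and [z = 'i] compares the real
    parts. *)
Lemma state_star x : omega (star x) = Num.conj (omega x).
Proof.
have [_ _ o1] := omega_state.
have e (z : R[i]) : complex.Im (z * omega x + Num.conj z * omega (star x)) = 0.
  have [+ _] := state_sqr_real (1 + z *: x).
  rewrite starD starZ star1 mulrDl !mulrDr !mul1r mulr1 -scalerAl -!scalerAr.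
  rewrite !linearD !linearZ /= o1.
  have [] := state_sqr_real x; case: (omega (star x * x)) => r s /= -> _.
  case: (omega x) (omega (star x)) z => a b [a' b'] [z1 z2] /=.
  lra.
have := e 1; have := e 'i; case: (omega x) (omega (star x)) => a b [a' b'] /=.
by move=> h1 h2; apply/eqP; rewrite eq_complex /=; apply/andP; split; apply/eqP; lra.
Qed.

Lemma l2norm_ge0 x : 0 <= l2 x.
Proof. exact: sqrtr_ge0. Qed.

Lemma l2norm_sqr x : l2 x ^+ 2 = complex.Re (omega (star x * x)).
Proof. by rewrite /l2 /l2norm sqr_sqrtr//; case: (state_sqr_real x). Qed.

Lemma Re_state_sym x y :
  complex.Re (omega (star x * y)) = complex.Re (omega (star y * x)).
Proof. by rewrite -[star y * x]starK state_star starM starK; case: (omega _). Qed.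

Lemma stateD x y : omega (x + y) = omega x + omega y :> R[i].
Proof. exact: linearD. Qed.

Lemma stateZ (z : R[i]) x : omega (z *: x) = z * omega x.
Proof. exact: linearZ. Qed.

Lemma state_sum (I : Type) (r : seq I) (F : I -> A) :
  omega (\sum_(i <- r) F i) = \sum_(i <- r) omega (F i) :> R[i].
Proof. exact: linear_sum. Qed.

Lemma l2norm_sqrD x y : l2 (x + y) ^+ 2 =
  l2 x ^+ 2 + 2 * complex.Re (omega (star x * y)) + l2 y ^+ 2.
Proof.
rewrite !l2norm_sqr starD mulrDl !mulrDr !stateD !ReD.
by rewrite (Re_state_sym y x); ring.
Qed.

Lemma l2normZ (z : R[i]) x : l2 (z *: x) = normc z * l2 x.
Proof.
apply/eqP; rewrite -(@eqrXn2 _ 2) ?l2norm_ge0 ?mulr_ge0 ?l2norm_ge0 ?normc_ge0//.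
rewrite exprMn !l2norm_sqr starZ -scalerAl -scalerAr !linearZ /= mulrA.
by rewrite conjcM_normc ReM_real.
Qed.

Lemma l2norm0 : l2 0 = 0.
Proof. by rewrite -[0](scale0r 0) l2normZ normc0 mul0r. Qed.

Lemma l2norm1 : l2 1 = 1.
Proof.
by rewrite /l2 /l2norm star1 mulr1; case: omega_state => _ _ ->; rewrite sqrtr1.
Qed.

Lemma state_cauchy_schwarz x y :
  complex.Re (omega (star x * y)) <= l2 x * l2 y.
Proof.
have h (r t : R) : 0 <= r ^+ 2 * l2 x ^+ 2
    + 2 * (r * t * complex.Re (omega (star x * y))) + t ^+ 2 * l2 y ^+ 2.
  have := sqr_ge0 (l2 (r%:C *: x + t%:C *: y)).
  rewrite l2norm_sqrD !l2normZ !exprMn !normc_real !real_normK ?num_real//.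
  rewrite starZ conjC_real -scalerAl -scalerAr !stateZ.
  by rewrite !ReM_real [r * (t * _)]mulrA.
have [x0 y0] := (l2norm_ge0 x, l2norm_ge0 y).
move: (complex.Re _) (l2 x) (l2 y) h x0 y0 => p a b h x0 y0.
have [a0|an0] := eqVneq a 0.
  rewrite a0 in h *.
  rewrite mul0r leNgt; apply/negP => p0.
  (* With [a = 0] the form is affine in [r]. This [r] brings it to [-2 (b^2 + 1) + b^2 < 0] if
     [p > 0]. *)
  have qE : (- (b ^+ 2 + 1) / p) * p = - (b ^+ 2 + 1) by rewrite divfK ?gt_eqF.
  by have := h (- (b ^+ 2 + 1) / p) 1; have := sqr_ge0 b; nra.
have [b0|bn0] := eqVneq b 0.
  rewrite b0 in h *.
  rewrite mulr0 leNgt; apply/negP => p0.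
  have qE : (- (a ^+ 2 + 1) / p) * p = - (a ^+ 2 + 1) by rewrite divfK ?gt_eqF.
  by have := h 1 (- (a ^+ 2 + 1) / p); have := sqr_ge0 a; nra.
have ab : 0 < a * b by rewrite mulr_gt0// lt0r ?x0 ?y0 andbT.
by rewrite -(ler_pM2l ab); have := h b (- a); nra.
Qed.

Lemma l2normN x : l2 (- x) = l2 x.
Proof. by rewrite -scaleN1r l2normZ normcN normc1 mul1r. Qed.

(** The square of the norm of [r x + t y] is a nonnegative quadratic form in the two real
    parameters. If both norms are nonzero, [r = l2 y] and [t = - l2 x] give the claim after division
    by [l2 x * l2 y]. *)
Lemma state_cauchy_schwarz_norm x y :
  `|complex.Re (omega (star x * y))| <= l2 x * l2 y.
Proof.
rewrite ler_norml state_cauchy_schwarz andbT lerNl.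
have := state_cauchy_schwarz x (- y).
by rewrite l2normN mulrN -scaleN1r stateZ mulN1r ReN.
Qed.

Lemma l2normD x y : l2 (x + y) <= l2 x + l2 y.
Proof.
rewrite -(@ler_pXn2r _ 2) ?nnegrE ?addr_ge0 ?l2norm_ge0// l2norm_sqrD.
by have := state_cauchy_schwarz x y; nra.
Qed.

(** * Operator norms on the GNS space and adjoints *)

Definition operator_on V X : Prop :=
  (forall x, V x -> V (X x)) /\
  forall (z : R[i]) x y, V x -> V y -> X (z *: x + y) = z *: X x + X y.

Lemma opnorm_le V X (M : R) : 0 <= M ->
  (forall x, V x -> l2 (X x) <= M * l2 x) -> (opnorm V omega X <= M%:E)%E.
Proof.
move=> M0 h; apply/ereal_supP => _ [x [Vx x1] <-].
by rewrite lee_fin (le_trans (h _ Vx))// ler_piMr.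
Qed.

Lemma opnorm_ge0 V X (M : R) : V 0 -> (opnorm V omega X <= M%:E)%E -> 0 <= M.
Proof.
move=> V0 /ereal_supP/(_ (l2 (X 0))%:E); rewrite lee_fin => h.
by apply: le_trans (h _); rewrite ?l2norm_ge0//; exists 0 => //; split => //;
  rewrite -/l2 l2norm0.
Qed.

Lemma opnorm_bound V X (M : R) : V 0 ->
    (forall (z : R[i]) a b, V a -> V b -> V (z *: a + b)) ->
    operator_on V X -> (opnorm V omega X <= M%:E)%E ->
  forall x, V x -> l2 (X x) <= M * l2 x.
Proof.
move=> V0 linV [VX linX] /[dup] /(opnorm_ge0 V0) M0 /ereal_supP h x Vx.
have X0 : X 0 = 0.
  by have := linX (-1) 0 0 V0 V0; rewrite !scaleN1r oppr0 addr0 addNr.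
have hr (r : R) : 0 <= r -> r * l2 x <= 1 -> r * l2 (X x) <= M.
  move=> r0 rx; have := linX r%:C x 0 Vx V0; rewrite X0 !addr0 => Xr.
  have := h (l2 (X (r%:C *: x)))%:E; rewrite lee_fin.
  rewrite Xr l2normZ normc_real ger0_norm//; apply; exists (r%:C *: x).
    split; first by rewrite -[_ *: _]addr0; exact: linV.
    by rewrite -/l2 l2normZ normc_real ger0_norm.
  by rewrite Xr -/l2 l2normZ normc_real ger0_norm.
have x0 := l2norm_ge0 x; have Xx0 := l2norm_ge0 (X x).
(* [l2] is only a seminorm here. If it vanishes at [x], every multiple of [x] lies in the unit ball,
   so the supremum bounds all multiples of [l2 (X x)], which must be 0. *)
have [xE|xn0] := eqVneq (l2 x) 0.
  rewrite xE mulr0 leNgt; apply/negP => Xx.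
  have := hr ((M + 1) / l2 (X x)); rewrite xE mulr0 divfK ?gt_eqF//.
  have r0 : 0 <= (M + 1) / l2 (X x) by rewrite divr_ge0// addr_ge0.
  by move=> /(_ r0 ler01); lra.
have xp : 0 < l2 x by rewrite lt0r xn0.
rewrite -ler_pdivrMr// mulrC; apply: hr; first by rewrite invr_ge0.
by rewrite mulVf.
Qed.

(** The sign is part of the relation because each commutator with [D] turns the adjoint into its
    negative. *)
Definition signed_adjoint V n X (Y : A -> A) : Prop :=
  forall x y, V x -> V y ->
    omega (star (X x) * y) = (-1) ^+ n * omega (star x * Y y).

(** Testing the relation at [x = Y y] gives [||Y y||^2 <= ||X (Y y)|| ||y|| <= M ||Y y|| ||y||],
    where the sign disappears in the absolute value. It remains to divide by [||Y y||]. *)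
Lemma opnorm_adjoint V n X (Y : A -> A) (M : R) : V 0 ->
    (forall (z : R[i]) a b, V a -> V b -> V (z *: a + b)) ->
    operator_on V X -> (forall y, V y -> V (Y y)) -> signed_adjoint V n X Y ->
  (opnorm V omega X <= M%:E)%E -> (opnorm V omega Y <= M%:E)%E.
Proof.
move=> V0 linV opX VY adj XM; have M0 := opnorm_ge0 V0 XM.
apply: opnorm_le => // y Vy; have VYy := VY _ Vy.
have [/eqP->|Yn0] := boolP (l2 (Y y) == 0); first by rewrite mulr_ge0// l2norm_ge0.
have Yp : 0 < l2 (Y y) by rewrite lt0r Yn0 l2norm_ge0.
rewrite -(ler_pM2r Yp) -expr2 mulrAC.
apply: le_trans (ler_wpM2r (l2norm_ge0 _) (opnorm_bound V0 linV opX XM VYy)).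
apply: le_trans (state_cauchy_schwarz_norm _ _); rewrite (adj _ _ VYy Vy).
rewrite l2norm_sqr -signr_odd; case: (odd n); rewrite ?mul1r ?mulN1r ?ReN ?normrN;
  exact: ler_norm.
Qed.

End States.

(** * Coordinates on C[G] *)

Section Coordinates.
Variables (R : realType) (G : discreteQG R).
Implicit Types (x y : G) (alpha beta : Irr G) (A : {fset Irr G}).
Let haarS := haar_state G.

Lemma CG_lin (z : R[i]) x y : CG G x -> CG G y -> CG G (z *: x + y).
Proof. by have [_ h _ _ _] := CG_dense G; exact: h. Qed.

Lemma CG1 : CG G 1. Proof. by have [] := CG_dense G. Qed.

Lemma CGM x y : CG G x -> CG G y -> CG G (x * y).
Proof. by have [_ _ h _ _] := CG_dense G; exact: h. Qed.

Lemma CG_star x : CG G x -> CG G (star x).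
Proof. by have [_ _ _ h _] := CG_dense G; exact: h. Qed.

Lemma CGD x y : CG G x -> CG G y -> CG G (x + y).
Proof. by move=> Cx Cy; rewrite -[x]scale1r; exact: CG_lin. Qed.

Lemma CG0 : CG G 0.
Proof. by have := CG_lin (-1) CG1 CG1; rewrite scaleN1r addNr. Qed.

Lemma CGZ (z : R[i]) x : CG G x -> CG G (z *: x).
Proof. by move=> Cx; rewrite -[_ *: _]addr0; apply: CG_lin => //; exact: CG0. Qed.

Lemma CGN x : CG G x -> CG G (- x).
Proof. by rewrite -scaleN1r; exact: CGZ. Qed.

Lemma CG_sum (I : Type) (r : seq I) (F : I -> G) :
  (forall i, CG G (F i)) -> CG G (\sum_(i <- r) F i).
Proof. by move=> CF; elim/big_ind: _ => //; [exact: CG0|exact: CGD]. Qed.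

Lemma CG_u alpha i j : CG G (u alpha i j).
Proof.
exists 1%N, (fun=> 1), (fun=> u alpha i j); split; first by exists alpha, i, j.
by rewrite big_ord1 scale1r.
Qed.

Lemma coef_inj x y : CG G x -> CG G y ->
  (forall alpha (i j : 'I_(dim alpha)), coef i j x = coef i j y) -> x = y.
Proof.
move=> Cx Cy xy; apply/eqP; rewrite -subr_eq0; apply/eqP.
have [A [_ ->]] := CG_expand (CGD Cx (CGN Cy)).
rewrite big1// => alpha _; rewrite big1// => i _; rewrite big1// => j _.
by rewrite linearB /= xy subrr scale0r.
Qed.

Lemma coef_sum A (w : forall alpha, 'I_(dim alpha) -> 'I_(dim alpha) -> R[i])
    alpha (i j : 'I_(dim alpha)) :
  coef i j (\sum_(beta <- A) \sum_k \sum_m w beta k m *: u beta k m) =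
  if alpha \in A then w alpha i j else 0.
Proof.
have coefE beta : coef i j (\sum_k \sum_m w beta k m *: u beta k m) =
  \sum_k \sum_m w beta k m * coef i j (u beta k m).
  rewrite linear_sum; apply: eq_bigr => k _; rewrite linear_sum.
  by apply: eq_bigr => m _; rewrite linearZ.
have coef0 beta : beta != alpha ->
    coef i j (\sum_k \sum_m w beta k m *: u beta k m) = 0.
  move=> ba; rewrite coefE big1// => k _; rewrite big1// => m _.
  by rewrite coef_u_neq ?mulr0// eq_sym.
rewrite linear_sum /=; case: ifPn => aA; last first.
  rewrite big_seq big1// => beta bA; apply: coef0.
  by apply: contraNneq aA => <-.
rewrite (bigD1_seq alpha) ?fset_uniq//= [X in _ + X]big1 ?addr0//.
rewrite coefE (bigD1 i)//= (bigD1 j)//= coef_u !eqxx mulr1.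
rewrite big1 ?addr0 => [|m mj]; last first.
  by rewrite coef_u [j == m]eq_sym (negPf mj) andbF mulr0.
rewrite big1 ?addr0// => k ki; rewrite big1// => m _.
by rewrite coef_u [i == k]eq_sym (negPf ki) mulr0.
Qed.

Lemma CG_sum_u A (w : forall alpha, 'I_(dim alpha) -> 'I_(dim alpha) -> R[i]) :
  CG G (\sum_(alpha <- A) \sum_i \sum_j w alpha i j *: u alpha i j).
Proof.
apply: CG_sum => alpha; apply: CG_sum => i; apply: CG_sum => j.
exact/CGZ/CG_u.
Qed.

(** [A] is any finite set containing the support, so that an element and its images under diagonal
    operators can be expanded over the same index set. *)
Definition supported_in A x : Prop :=
  CG G x /\ forall alpha, alpha \notin A ->
    forall i j : 'I_(dim alpha), coef i j x = 0.

Lemma CG_supported x : CG G x -> exists A, supported_in A x.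
Proof.
by move=> Cx; have [A [xA _]] := CG_expand Cx; exists A; split=> // *; exact: xA.
Qed.

Lemma supported_expand A x : supported_in A x ->
  x = \sum_(alpha <- A) \sum_i \sum_j coef i j x *: u alpha i j.
Proof.
case=> Cx xA; apply: coef_inj => //; first exact: CG_sum_u.
move=> alpha i j; rewrite (coef_sum A (fun alpha i j => coef i j x)).
by case: ifPn => // /xA.
Qed.

Lemma diag_op_expand d A x : supported_in A x -> diag_op d x =
  \sum_(alpha <- A) \sum_i \sum_j ((d alpha i)%:C * coef i j x) *: u alpha i j.
Proof.
case=> _ xA; rewrite /diag_op (fsbigTE A)// => alpha aA.
by rewrite big1// => i _; rewrite big1// => j _; rewrite xA// mulr0 scale0r.
Qed.

Lemma CG_diag_op d x : CG G x -> CG G (diag_op d x).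
Proof.
by case/CG_supported=> A xA; rewrite (diag_op_expand d xA); exact: CG_sum_u.
Qed.

Lemma coef_diag_op d x alpha (i j : 'I_(dim alpha)) :
  CG G x -> coef i j (diag_op d x) = (d alpha i)%:C * coef i j x.
Proof.
case/CG_supported=> A xA; rewrite (diag_op_expand d xA).
rewrite (coef_sum A (fun alpha i j => (d alpha i)%:C * coef i j x)).
by case: ifPn => // /(proj2 xA) ->; rewrite mulr0.
Qed.

Lemma diag_op_operator d : operator_on (CG G) (@diag_op R G d).
Proof.
split=> [x|z x y Cx Cy]; first exact: CG_diag_op.
have [Dx Dy] := (CG_diag_op d Cx, CG_diag_op d Cy).
apply: coef_inj => [||alpha i j]; [exact/CG_diag_op/CG_lin|exact: CG_lin|].
rewrite coef_diag_op; last exact: CG_lin.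
by rewrite !linearP /= !coef_diag_op// mulrDr mulrCA.
Qed.

Lemma diag_op0 d : diag_op d 0 = 0 :> G.
Proof.
have [_ dlin] := diag_op_operator d.
by have := dlin (-1) 0 0 CG0 CG0; rewrite !scaleN1r oppr0 addr0 addNr.
Qed.

Lemma diag_opZ d (z : R[i]) x : CG G x -> diag_op d (z *: x) = z *: diag_op d x.
Proof.
have [_ dlin] := diag_op_operator d.
by move=> Cx; have := dlin z x 0 Cx CG0; rewrite diag_op0 !addr0.
Qed.

Lemma diag_opC d e x : CG G x ->
  diag_op d (diag_op e x) = diag_op e (diag_op d x).
Proof.
move=> Cx; have [dx ex] := (CG_diag_op d Cx, CG_diag_op e Cx).
apply: coef_inj => [||alpha i j]; [exact: CG_diag_op|exact: CG_diag_op|].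
by rewrite !coef_diag_op// mulrCA.
Qed.

Lemma dimq_modF_gt0 alpha (i : 'I_(dim alpha)) : 0 < dimq alpha * modF i.
Proof.
by rewrite mulr_gt0 ?modF_gt0// dimq_gt0// (leq_ltn_trans (leq0n i) (ltn_ord i)).
Qed.

Lemma diag_op_u d alpha (i j : 'I_(dim alpha)) :
  diag_op d (u alpha i j) = (d alpha i)%:C *: u alpha i j :> G.
Proof.
have Cu := CG_u i j; apply: coef_inj => [||beta k m].
- exact: CG_diag_op.
- exact: CGZ.
rewrite coef_diag_op// linearZ /=; have [ba|ba] := eqVneq beta alpha.
  subst beta; rewrite coef_u; have [->|ki] := eqVneq k i => //=.
  by rewrite !mulr0.
by rewrite coef_u_neq// !mulr0.
Qed.

Lemma haar_star_u x alpha (i j : 'I_(dim alpha)) :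
  haar G (star x * u alpha i j) =
  Num.conj (coef i j x) * ((dimq alpha * modF i)^-1)%:C.
Proof.
rewrite -[star x * _]starK starM starK (state_star haarS) /coef.
move: (dimq alpha * modF i) (dimq_modF_neq0 i) => r r0.
by rewrite conjC_realM mulrAC -rmorphM /= mulfV// rmorph1 mul1r.
Qed.

(** Only [y] is expanded; the pairing of [x] with each [u alpha i j] is already a conjugated
    coordinate. The weight is the squared norm of [u alpha i j] and depends on the row [i]. *)
Lemma parseval A x y : supported_in A y ->
  haar G (star x * y) = \sum_(alpha <- A) \sum_(i < dim alpha) \sum_(j < dim alpha)
    Num.conj (coef i j x) * coef i j y * ((dimq alpha * modF i)^-1)%:C.
Proof.
move=> yA; rewrite {1}(supported_expand yA) mulr_sumr linear_sum.
apply: eq_bigr => alpha _; rewrite mulr_sumr linear_sum.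
apply: eq_bigr => i _; rewrite mulr_sumr linear_sum.
apply: eq_bigr => j _.
by rewrite -scalerAr linearZ /= haar_star_u mulrA [coef i j y * _]mulrC.
Qed.

Lemma l2norm_parseval A x : supported_in A x ->
  l2norm (haar G) x ^+ 2 =
  \sum_(alpha <- A) \sum_(i < dim alpha) \sum_(j < dim alpha)
    normc (coef i j x) ^+ 2 / (dimq alpha * modF i).
Proof.
move=> xA; rewrite (l2norm_sqr haarS) (parseval x xA) Re_sum.
apply: eq_bigr => alpha _; rewrite Re_sum; apply: eq_bigr => i _; rewrite Re_sum.
by apply: eq_bigr => j _; rewrite conjcM_normc -rmorphM.
Qed.

Lemma coef_le_l2norm x alpha (i j : 'I_(dim alpha)) : CG G x ->
  normc (coef i j x) ^+ 2 / (dimq alpha * modF i) <= l2norm (haar G) x ^+ 2.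
Proof.
case/CG_supported=> A xA; have [aA|/(proj2 xA)->] := boolP (alpha \in A); last first.
  by rewrite normc0 expr0n mul0r sqr_ge0.
have pos beta (k m : 'I_(dim beta)) :
    0 <= normc (coef k m x) ^+ 2 / (dimq beta * modF k).
  by rewrite divr_ge0 ?sqr_ge0// ltW// dimq_modF_gt0.
rewrite (l2norm_parseval xA) (bigD1_seq alpha) ?fset_uniq//= ler_wpDr//.
  by rewrite sumr_ge0// => beta _; rewrite sumr_ge0// => k _; rewrite sumr_ge0.
rewrite (bigD1 i)//= ler_wpDr//.
  by rewrite sumr_ge0// => k _; rewrite sumr_ge0.
by rewrite (bigD1 j)//= ler_wpDr// sumr_ge0.
Qed.

(** Faithfulness of the Haar state on [C[G]]: the norm dominates each coordinate. *)
Lemma l2norm_eq0 x : CG G x -> l2norm (haar G) x = 0 -> x = 0.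
Proof.
move=> Cx x0; apply: coef_inj => // [|alpha i j]; first exact: CG0.
have := coef_le_l2norm i j Cx; rewrite linear0 x0 expr0n /=.
rewrite pmulr_lle0 ?invr_gt0 ?dimq_modF_gt0//.
by move=> c0; apply/eq0_normc/eqP; rewrite -sqrf_eq0 eq_le c0 sqr_ge0.
Qed.

(** Diagonal operators with real weights are symmetric. This applies to both [D] and [T]. *)
Lemma haar_diag_op d x y : CG G x -> CG G y ->
  haar G (star (diag_op d x) * y) = haar G (star x * diag_op d y).
Proof.
move=> Cx Cy; have [A yA] := CG_supported Cy.
have dyA : supported_in A (diag_op d y).
  split=> [|alpha aA i j]; first exact: CG_diag_op.
  by rewrite coef_diag_op// (proj2 yA)// mulr0.
rewrite (parseval _ yA) (parseval _ dyA).
apply: eq_bigr => alpha _; apply: eq_bigr => i _; apply: eq_bigr => j _.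
rewrite !coef_diag_op// conjC_realM; congr (_ * _).
by rewrite -mulrA mulrCA.
Qed.

End Coordinates.

(** * The twisted derivation *)

Section Derivation.
Variables (R : realType) (G : discreteQG R) (l : Irr G -> R) (k : nat).
Implicit Types (a x y : G) (X Y Z : G -> G).
Let haarS := haar_state G.
Let d := delta_T l k.
Let D := Dop l.
Let T := @Top R G k.

Lemma delta_T_operator X : operator_on (CG G) X -> operator_on (CG G) (d X).
Proof.
have [DC Dlin] := diag_op_operator (fun alpha (_ : 'I_(dim alpha)) => l alpha).
have [TC Tlin] := diag_op_operator
  (fun alpha i => @Cdiag R G alpha i `^ ((2 * k)%:R)^-1).
case=> XC Xlin; split=> [x Cx|z x y Cx Cy]; rewrite /d /delta_T /Dop /Top.
  apply: CGD; first exact/DC/TC/XC/TC.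
  exact/CGN/TC/XC/TC/DC.
have [Tx Ty] := (TC _ Cx, TC _ Cy); have [Dx Dy] := (DC _ Cx, DC _ Cy).
rewrite (Tlin _ _ _ Cx Cy) (Dlin _ _ _ Cx Cy).
rewrite (Xlin _ _ _ Tx Ty) (Tlin _ _ _ Dx Dy).
have [XTx XTy] := (XC _ Tx, XC _ Ty); have [TDx TDy] := (TC _ Dx, TC _ Dy).
rewrite (Xlin _ _ _ TDx TDy) (Tlin _ _ _ XTx XTy) (Tlin _ _ _ (XC _ TDx) (XC _ TDy)).
rewrite (Dlin _ _ _ (TC _ XTx) (TC _ XTy)) opprD addrACA.
by rewrite scalerBr.
Qed.

Lemma iter_delta_T_operator n X :
  operator_on (CG G) X -> operator_on (CG G) (iter n d X).
Proof. by move=> opX; elim: n => //= n; exact: delta_T_operator. Qed.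

Lemma lmul_operator a : CG G a -> operator_on (CG G) (fun x => a * x).
Proof.
move=> Ca; split=> [x|z x y _ _]; first exact: CGM.
by rewrite mulrDr scalerAr.
Qed.

(** As [D] and [T] are symmetric, the adjoint of [D T X T - T X T D] is [T X' T D - D T X' T = -
    [D, T X' T]], with [X'] the adjoint of [X]; hence one more sign. *)
Lemma delta_T_adjoint n X Y :
    operator_on (CG G) X -> operator_on (CG G) Y ->
  signed_adjoint (haar G) (CG G) n X Y ->
  signed_adjoint (haar G) (CG G) n.+1 (d X) (d Y).
Proof.
move=> [XC _] [YC _] adj x y Cx Cy; rewrite /d /delta_T -/D -/T.
have DC z : CG G z -> CG G (D z) by exact: CG_diag_op.
have TC z : CG G z -> CG G (T z) by exact: CG_diag_op.
have [Tx Ty] := (TC _ Cx, TC _ Cy); have [Dx Dy] := (DC _ Cx, DC _ Cy).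
have [TDx TDy] := (TC _ Dx, TC _ Dy).
have [XTx YTy] := (XC _ Tx, YC _ Ty); have [XTDx YTDy] := (XC _ TDx, YC _ TDy).
rewrite starB mulrBl mulrBr !linearB /=.
rewrite haar_diag_op//; last exact: TC.
rewrite haar_diag_op// -/T adj// haar_diag_op// -/T.
rewrite [in X in _ - X]haar_diag_op// -/T adj// haar_diag_op// -/T.
rewrite haar_diag_op//; last exact: TC.
by rewrite exprS mulN1r mulNr -mulrBr -mulrN opprB.
Qed.

Lemma iter_delta_T_adjoint n a : CG G a ->
  signed_adjoint (haar G) (CG G) n (iter n d (fun x => a * x))
    (iter n d (fun x => star a * x)).
Proof.
move=> Ca; elim: n => [|n IHn] /=.
  by move=> x y _ _; rewrite mul1r starM mulrA.
apply: delta_T_adjoint => //; apply: iter_delta_T_operator;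
  apply: lmul_operator => //.
exact: CG_star.
Qed.

Lemma iter_delta_T_lin n (z : R[i]) a b : CG G a -> CG G b ->
  forall x, CG G x -> iter n d (fun x => (z *: a + b) * x) x =
    z *: iter n d (fun x => a * x) x + iter n d (fun x => b * x) x.
Proof.
move=> Ca Cb.
have [DC Dlin] := diag_op_operator (fun alpha (_ : 'I_(dim alpha)) => l alpha).
have [TC Tlin] := diag_op_operator
  (fun alpha i => @Cdiag R G alpha i `^ ((2 * k)%:R)^-1).
elim: n => [|n IHn] x Cx /=; first by rewrite mulrDl scalerAl.
have [aC _] := iter_delta_T_operator n (lmul_operator Ca).
have [bC _] := iter_delta_T_operator n (lmul_operator Cb).
rewrite /d /delta_T -/d.
have Tx := TC _ Cx; have TDx := TC _ (DC _ Cx).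
rewrite !IHn//.
rewrite /Dop /Top (Tlin _ _ _ (aC _ Tx) (bC _ Tx)).
rewrite (Tlin _ _ _ (aC _ TDx) (bC _ TDx)).
rewrite (Dlin _ _ _ (TC _ (aC _ Tx)) (TC _ (bC _ Tx))) opprD addrACA.
by rewrite scalerBr.
Qed.

(** The first commutator is [z [D, T^2]], which vanishes because diagonal operators commute. Further
    commutators are then taken of zero. *)
Lemma delta_T_scalar n (z : R[i]) x : (0 < n)%N -> CG G x ->
  iter n d (fun x => z%:A * x) x = 0.
Proof.
move=> n0; case: n n0 => // n _; elim: n x => [|n IHn] x Cx.
  have Tx := CG_diag_op (fun alpha i => @Cdiag R G alpha i `^ ((2 * k)%:R)^-1) Cx.
  have Dx := CG_diag_op (fun alpha (_ : 'I_(dim alpha)) => l alpha) Cx.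
  rewrite /= /d /delta_T !mulr_algl /Dop /Top.
  rewrite ![diag_op _ (z *: _)]diag_opZ; do ?exact: CG_diag_op.
  by rewrite [diag_op _ (diag_op (fun alpha _ => l alpha) x)]diag_opC//
    [in X in _ - X]diag_opC// subrr.
rewrite iterS /d /delta_T -/d /Dop /Top !IHn; do ?[apply: CG_diag_op|exact: Cx].
by rewrite !diag_op0 subr0.
Qed.

(* As [D 1 = 0], the second term of the commutator vanishes on [1]. *)
Lemma coef_delta_T_one n X (t : R) alpha (i j : 'I_(dim alpha)) :
    operator_on (CG G) X -> D 1 = 0 -> T 1 = t%:C *: 1 ->
  coef i j (iter n d X 1) =
  ((t * (l alpha * Cdiag i `^ ((2 * k)%:R)^-1)) ^+ n)%:C * coef i j (X 1).
Proof.
move=> opX D1 T1; elim: n => [|n IHn] /=; first by rewrite mul1r.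
have [XC Xlin] := iter_delta_T_operator n opX.
have X0 : iter n d X 0 = 0.
  by have := Xlin (-1) 0 0 (CG0 G) (CG0 G); rewrite !scaleN1r oppr0 addr0 addNr.
rewrite {1}/d /delta_T -/d -/D -/T D1 T1 [T 0]diag_op0 X0 [T 0]diag_op0 subr0.
have -> : iter n d X (t%:C *: 1) = t%:C *: iter n d X 1.
  by rewrite -[t%:C *: 1]addr0 Xlin ?X0 ?addr0//; [exact: CG1|exact: CG0].
have Cn := XC _ (CG1 G).
rewrite /D /Dop coef_diag_op; last by apply: CG_diag_op; exact: CGZ.
rewrite /T /Top coef_diag_op; last exact: CGZ.
rewrite linearZ /= IHn exprS !rmorphM /=; ring.
Qed.

End Derivation.

(** * Balls of the word length and Sobolev norms *)

Section Words.
Variables (R : realType) (G : discreteQG R).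
Implicit Types (x : G) (alpha beta : Irr G) (l : Irr G -> R).

Lemma scalar_mx_inM m n p (T : 'M[R[i]]_(m, n)) (T' : 'M_(n, p)) :
  scalar_mx_in G (T *m T') = scalar_mx_in G T *m scalar_mx_in G T'.
Proof. exact: map_mxM. Qed.

Lemma scalar_mx_in1 n : scalar_mx_in G (1%:M : 'M_n) = 1%:M.
Proof. exact: map_mx1. Qed.

(** The 1 by 1 identity is an irreducible unitary corepresentation, hence equivalent to some
    [u alpha], and conjugating an identity by scalar matrices leaves an identity. This exhibits 1 as
    a matrix coefficient, so that [D 1] and [T 1] can be computed. *)
Lemma trivial_irr_ex :
  exists alpha (i : 'I_(dim alpha)), trivial_irr alpha /\ u alpha i i = 1 :> G.
Proof.
have [||alpha eqv] := @irr_surj R G 1 1%:M.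
- have star_1 : star_mx (1%:M : 'M[G]_1) = 1%:M.
    by apply/matrixP => i j; rewrite !mxE !ord1 star1.
  split=> [i j||]; rewrite ?star_1 ?trmx1 ?mulmx1//.
  by rewrite big_ord1 !ord1 !mxE !rmorph1 mulr1.
- split=> // T _; apply/is_scalar_mxP; exists (T 0 0).
  by apply/matrixP => i j; rewrite !ord1 mxE eqxx.
have [d0 _] := irr_irreducible alpha; exists alpha, (Ordinal d0); split=> //.
have [T [T' [TT' _ int]]] := eqv.
have -> : u alpha = 1%:M.
  rewrite -[u alpha]mulmx1 -scalar_mx_in1 -TT' scalar_mx_inM mulmxA int mulmx1.
  by rewrite -scalar_mx_inM TT' scalar_mx_in1.
by rewrite mxE eqxx.
Qed.

(** As a compression of [v], the corepresentation [w] has entries that are linear combinations of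
    those of [v]. *)
Lemma subcorepE m n (w : 'M[G]_n) (v : 'M[G]_m) : subcorep w v ->
  exists T T', T' *m T = 1%:M /\ w = scalar_mx_in G T' *m v *m scalar_mx_in G T.
Proof.
case=> T [T' [T'T int]]; exists T, T'; split=> //.
by rewrite -mulmxA int mulmxA -scalar_mx_inM T'T scalar_mx_in1 mul1mx.
Qed.

Lemma subcorep_nil alpha : subcorep (u alpha) (word_corep (G := G) [::]) ->
  u alpha = 1%:M.
Proof.
case/subcorepE=> T [T' [T'T ->]]; rewrite mulmx1.
by rewrite -scalar_mx_inM T'T scalar_mx_in1.
Qed.

Lemma CG_word_corep w i j : CG G (word_corep w i j).
Proof.
elim: w i j => [|alpha w IHw] i j /=; last first.
  by rewrite mxE; apply: CGM; [exact: CG_u|].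
by rewrite mxE; case: (i == j); [exact: CG1|exact: CG0].
Qed.

(** No decomposition into irreducibles is used. If [u alpha] is a compression of [v], its diagonal
    entry has coordinate 1 on itself, so some entry of [v] has a nonzero coordinate in the block
    [alpha]. There are finitely many entries, each of finite support. *)
Lemma finite_subcorep n (v : 'M[G]_n) : (forall i j, CG G (v i j)) ->
  finite_set [set alpha | subcorep (u alpha) v]%classic.
Proof.
move=> Cv; pose S p q := [set alpha | exists i j : 'I_(dim alpha),
   coef i j (v p q) != 0]%classic.
have finS p q : finite_set (S p q).
  have [A [_ vA]] := CG_supported (Cv p q).
  apply: (@sub_finite_set _ _ [set` A]%classic) => // alpha [i [j]].
  by apply: contraNT => /vA ->.
have fin : finite_set (\bigcup_(p in setT) \bigcup_(q in setT) S p q)%classic.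
  by apply: bigcup_finite => // p _; exact: bigcup_finite.
apply: sub_finite_set fin => alpha /= /subcorepE[T [T' [_ uE]]].
have [d0 _] := irr_irreducible alpha; pose i := Ordinal d0.
apply: contrapT => nS.
have : coef i i (u alpha i i) = 0 :> R[i].
  rewrite [in X in coef _ _ X]uE mxE linear_sum big1// => q _.
  rewrite mxE mulr_suml linear_sum big1//= => p _.
  rewrite !mxE /= mulr_algl mulr_algr !linearZ /=.
  have [->|vn0] := eqVneq (coef i i (v p q)) 0; first by rewrite !mulr0.
  by case: nS; exists p => //; exists q => //; exists i, i.
by rewrite coef_u !eqxx => /eqP; rewrite oner_eq0.
Qed.

Lemma finite_words (T : eqType) (D : seq T) n : exists ws : seq (seq T),
  forall w, size w = n -> {subset w <= D} -> w \in ws.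
Proof.
elim: n => [|n [ws IHn]]; first by exists [:: [::]] => -[].
exists [seq d :: w | d <- D, w <- ws] => -[//|d w] [sw] wD.
apply: allpairs_f; first by apply: wD; rewrite mem_head.
by apply: IHn => // e ew; apply: wD; rewrite inE ew orbT.
Qed.

(** Each [alpha] in the ball occurs in a word of length less than [N] over the finite set [D]. There
    are finitely many such words, and each contains finitely many irreducibles. *)
Lemma finite_ball l N : word_length_function l ->
  finite_set [set alpha | l alpha < N%:R]%classic.
Proof.
case=> _ [D _ lD]; have /choice[ws wsD] := @finite_words _ D.
pose S n := (\bigcup_(w in [set` ws n])
  [set alpha | subcorep (u alpha) (word_corep w)])%classic.
have fin : finite_set (\bigcup_(n in `I_N) S n)%classic.
  apply: bigcup_finite => // n _; apply: bigcup_finite => // w _.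
  by apply: finite_subcorep; exact: CG_word_corep.
apply: sub_finite_set fin => alpha /=.
have [m [-> [[w [sw wD sub]] _]]] := lD alpha; rewrite ltr_nat => mN.
by exists m => //; exists w => //=; exact: wsD.
Qed.

Lemma word_length_nat l alpha : word_length_function l ->
  exists m : nat, l alpha = m%:R.
Proof. by case=> _ [D _ lD]; have [m [lm _]] := lD alpha; exists m. Qed.

Lemma word_length_eq0 l alpha : word_length_function l -> l alpha = 0 ->
  u alpha = 1%:M.
Proof.
case=> _ [D _ lD]; have [m [-> [[w [sw _ sub]] _]]] := lD alpha.
move/eqP; rewrite pnatr_eq0 -sw size_eq0 => /eqP w0.
by apply: subcorep_nil; rewrite -w0.
Qed.

Lemma Cdiag_gt0 alpha (i : 'I_(dim alpha)) : 0 < Cdiag i.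
Proof.
have d0 : (0 < dim alpha)%N by case: i => m; case: (dim alpha).
by rewrite mulr_gt0 ?modF_gt0// divr_gt0 ?ltr0n// dimq_gt0.
Qed.

(** The twist by [C] cancels the modular weight in the Haar inner product. This is what makes the
    norm of [delta_T^k(a) 1] comparable with a Sobolev norm. *)
Lemma Cdiag_div alpha (i : 'I_(dim alpha)) :
  Cdiag i / (dimq alpha * modF i) = (dim alpha)%:R^-1.
Proof.
by rewrite /Cdiag [_ / _ * modF i]mulrAC [LHS]mulrAC divff ?dimq_modF_neq0// mul1r.
Qed.

Lemma phi_block_gram alpha (g : 'M[R[i]]_(dim alpha)) :
  phi_block ((map_mx (@conjc R) g)^T *m g) =
  (\sum_i \sum_j dimq alpha * modF j * normc (g i j) ^+ 2)%:C.
Proof.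
rewrite /phi_block /mxtrace mul_diag_mx [in RHS]exchange_big [RHS]real_complex_sum.
rewrite mulr_sumr; apply: eq_bigr => j _.
rewrite !mxE /= !mulr_sumr [RHS]real_complex_sum.
apply: eq_bigr => i _; rewrite !mxE [_ * g i j]conjcM_normc.
by rewrite mulrA -!rmorphM.
Qed.

(** In column [j], [fourier_inv] contributes the square of [1 / (dimq alpha * modF j)], [Csqrt]
    contributes [Cdiag j], and [phi] contributes [dimq alpha * modF j]. The product is
    [1 / dim alpha]. *)
Lemma sobolev_norm_sqr l (s : R) A x : supported_in A x ->
  sobolev_norm l s x ^+ 2 = \sum_(alpha <- A)
    \sum_(i < dim alpha) \sum_(j < dim alpha)
      ((1 + l alpha) `^ s) ^+ 2 * (normc (coef i j x) ^+ 2 / (dim alpha)%:R).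
Proof.
move=> [Cx xA]; rewrite /sobolev_norm /sobolev_norm_fun /phi.
under eq_fsbigr do rewrite phi_block_gram.
rewrite (fsbigTE A) => [|alpha aA]; last first.
  rewrite big1 ?rmorph0// => i _; rewrite big1// => j _.
  rewrite !mxE big1 ?mulr0 ?normc0 ?expr0n ?mulr0// => m _.
  by rewrite fourier_invE// xA// mul0r mul0r.
rewrite Re_sum sqr_sqrtr; last first.
  apply: sumr_ge0 => alpha _ /=.
  rewrite sumr_ge0// => i _; rewrite sumr_ge0// => j _.
  by rewrite mulr_ge0 ?sqr_ge0// ltW// dimq_modF_gt0.
apply: eq_bigr => alpha _ /=; apply: eq_bigr => i _; apply: eq_bigr => j _.
rewrite mxE mul_mx_diag mxE fourier_invE// mxE.
move: (coef i j x) => z.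
rewrite !normcM normcV !normc_real !exprMn !real_normK ?num_real//.
rewrite sqr_sqrtr ?ltW ?Cdiag_gt0// -(Cdiag_div j) exprVn real_normK ?num_real//.
by move: (dimq alpha * modF j) (dimq_modF_neq0 j) => r r0; field.
Qed.

End Words.

(** * The seminorm is Lipschitz *)

Section Seminorm.
Variables (R : realType) (G : discreteQG R) (l : Irr G -> R) (k : nat).
Variables (L : G -> R).
Hypotheses (hl : word_length_function l) (hk : (0 < k)%N) (hL : is_LkT l k L).
Implicit Types (a b x y : G) (alpha beta : Irr G).
Let haarS := haar_state G.
Let l2 := l2norm (haar G).
Let Delta a := iter k (delta_T l k) (fun x => a * x).

Lemma Delta_operator a : CG G a -> operator_on (CG G) (Delta a).
Proof. by move=> Ca; exact/iter_delta_T_operator/lmul_operator. Qed.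

Lemma LkT_bound a x : CG G a -> CG G x -> l2 (Delta a x) <= L a * l2 x.
Proof.
move=> Ca; apply: (opnorm_bound haarS (CG0 G) (@CG_lin R G)) => //.
  exact: Delta_operator.
by rewrite hL.
Qed.

Lemma LkT_le a (M : R) : CG G a -> 0 <= M ->
  (forall x, CG G x -> l2 (Delta a x) <= M * l2 x) -> L a <= M.
Proof. by move=> Ca M0 h; rewrite -lee_fin hL//; exact: opnorm_le. Qed.

Lemma LkT_ge0 a : CG G a -> 0 <= L a.
Proof.
move=> Ca; apply: (@opnorm_ge0 _ _ (haar G) haarS (CG G) (Delta a)) => //.
  exact: CG0.
by rewrite hL.
Qed.

Lemma LkTD a b : CG G a -> CG G b -> L (a + b) <= L a + L b.
Proof.
move=> Ca Cb; apply: LkT_le => [||x Cx]; [exact: CGD|by rewrite addr_ge0// LkT_ge0|].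
have -> : Delta (a + b) x = Delta a x + Delta b x.
  by have := iter_delta_T_lin l k k 1 Ca Cb Cx; rewrite !scale1r.
apply: le_trans (l2normD haarS _ _) _; rewrite mulrDl.
by apply: lerD; exact: LkT_bound.
Qed.

Lemma Delta_scale (z : R[i]) a x : CG G a -> CG G x ->
  Delta (z *: a) x = z *: Delta a x.
Proof.
move=> Ca Cx; have := iter_delta_T_lin l k k z Ca (CG0 G) Cx.
(* This instance shows that [Delta 0 x = 0]. *)
have := iter_delta_T_lin l k k (-1) (CG0 G) (CG0 G) Cx.
by rewrite !scaleN1r oppr0 !addr0 addNr /Delta => -> ->; rewrite addr0.
Qed.

Lemma LkTZ (z : R[i]) a : CG G a -> L (z *: a) = normc z * L a.
Proof.
have le w b : CG G b -> L (w *: b) <= normc w * L b.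
  move=> Cb; apply: LkT_le => [||x Cx]; first exact: CGZ.
    by rewrite mulr_ge0 ?normc_ge0 ?LkT_ge0.
  rewrite Delta_scale// /l2 l2normZ// -mulrA ler_wpM2l ?normc_ge0//.
  exact: LkT_bound.
move=> Ca; apply/le_anti; rewrite le//=.
have [->|z0] := eqVneq z 0.
  by rewrite normc0 mul0r LkT_ge0//; exact: CGZ.
have nz : 0 < normc z.
  rewrite lt0r normc_ge0 andbT; apply: contra_neq z0; exact: eq0_normc.
(* The reverse inequality is the one already proved, for the scalar [z^-1] and the element
   [z *: a]. *)
have := le z^-1 (z *: a) (CGZ z Ca).
by rewrite scalerA mulVf// scale1r normcV mulrC ler_pdivlMr// mulrC.
Qed.

Lemma LkT_star a : CG G a -> L (star a) = L a.
Proof.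
have le b : CG G b -> L (star b) <= L b.
  move=> Cb; have Csb := CG_star Cb; rewrite -lee_fin [leLHS]hL//.
  apply: (opnorm_adjoint haarS (CG0 G) (@CG_lin R G) (Delta_operator Cb)).
  - exact: (Delta_operator Csb).1.
  - exact: iter_delta_T_adjoint.
  - by rewrite hL.
move=> Ca; apply/le_anti; rewrite le//=.
by rewrite -{1}[a]starK; apply: le; exact: CG_star.
Qed.

Lemma LkT_scalar (z : R[i]) : L z%:A = 0.
Proof.
have Cz : CG G z%:A by apply: CGZ; exact: CG1.
apply/le_anti; rewrite LkT_ge0// andbT.
apply: LkT_le => // x Cx; rewrite /Delta delta_T_scalar// /l2 l2norm0//.
by rewrite mul0r.
Qed.

Lemma Dop_one : Dop l 1 = 0 :> G.
Proof.
have [alpha [i [triv u1]]] := trivial_irr_ex G.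
have [[_ l0 _ _] _] := hl.
by rewrite -u1 /Dop diag_op_u l0// scale0r.
Qed.

Lemma Top_one : exists2 t : R, 0 < t & Top k 1 = t%:C *: 1 :> G.
Proof.
have [alpha [i [_ u1]]] := trivial_irr_ex G.
exists (Cdiag i `^ ((2 * k)%:R)^-1); first by rewrite powR_gt0// Cdiag_gt0.
by rewrite -u1 /Top diag_op_u.
Qed.

Lemma Cdiag_root alpha (i : 'I_(dim alpha)) :
  (Cdiag i `^ ((2 * k)%:R)^-1) ^+ (2 * k) = Cdiag i.
Proof.
rewrite -powR_mulrn ?powR_ge0// -powRrM mulVf ?powRr1 ?ltW ?Cdiag_gt0//.
by rewrite pnatr_eq0 muln_eq0 /= -lt0n.
Qed.

(** The factor [Cdiag i] to the power [1/(2k)] enters once per commutator and is then squared,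
    giving [Cdiag i] itself; divided by [dimq alpha * modF i] it leaves [1 / dim alpha]. *)
Lemma coef_Delta_one (t : R) a alpha (i j : 'I_(dim alpha)) :
    Top k 1 = t%:C *: 1 :> G -> CG G a ->
  normc (coef i j (Delta a 1)) ^+ 2 / (dimq alpha * modF i) =
  ((t * l alpha) ^+ k) ^+ 2 * (normc (coef i j a) ^+ 2 / (dim alpha)%:R).
Proof.
move=> T1 Ca; rewrite (coef_delta_T_one _ _ _ (lmul_operator Ca) Dop_one T1) mulr1.
move: (coef i j a) => z; rewrite normcM normc_real exprMn real_normK ?num_real//.
have sqrE (w : R) : (t * (l alpha * w)) ^+ k ^+ 2 =
    ((t * l alpha) ^+ k) ^+ 2 * w ^+ (2 * k).
  by rewrite mulrA exprMn exprMn mulnC exprM.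
by rewrite sqrE Cdiag_root -(Cdiag_div i); ring.
Qed.

Lemma LkT_eq0 a : CG G a -> L a = 0 -> exists z : R[i], a = z%:A.
Proof.
move=> Ca La; have [t t0 T1] := Top_one.
have D1 : Delta a 1 = 0.
  apply: l2norm_eq0; first by apply: (Delta_operator Ca).1; exact: CG1.
  apply/le_anti; rewrite l2norm_ge0 andbT.
  by have := LkT_bound Ca (CG1 G); rewrite La mul0r.
(* On a block of length 0 the matrix [u alpha] is the identity, so its entries are scalars; on every
   other block the coordinate of [a] vanishes because that of [Delta a 1] does. *)
have h alpha (i j : 'I_(dim alpha)) :
    exists z : R[i], coef i j a *: u alpha i j = z%:A.
  have [lE|ln] := eqVneq (l alpha) 0.
    rewrite (word_length_eq0 hl lE) mxE; exists (coef i j a * (i == j)%:R).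
    by case: (i == j); rewrite ?mulr1// mulr0 !scale0r ?scaler0.
  exists 0; suff -> : coef i j a = 0 by rewrite !scale0r.
  have := coef_Delta_one i j T1 Ca; rewrite D1 linear0 normc0 expr0n mul0r.
  move/esym/eqP; rewrite !(mulf_eq0, expf_eq0) /= hk /= (gt_eqF t0) (negPf ln) /=.
  rewrite orbb invr_eq0 pnatr_eq0; case/orP => [/eqP c0|]; first exact: eq0_normc.
  by move/eqP => d0; have := leq_ltn_trans (leq0n i) (ltn_ord i); rewrite d0.
have [A aA] := CG_supported Ca; rewrite (supported_expand aA).
have scal (I : Type) (r : seq I) (F : I -> G) :
    (forall i, exists z : R[i], F i = z%:A) ->
    exists z : R[i], \sum_(i <- r) F i = z%:A.
  move=> hF; elim/big_rec: _ => [|i x _ [z ->]]; first by exists 0; rewrite scale0r.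
  by have [w ->] := hF i; exists (w + z); rewrite scalerDl.
by apply/scal => alpha; apply/scal => i; apply/scal => j; exact: h.
Qed.

Lemma LkT_lipschitz : lipschitz_seminorm (CG G) L.
Proof.
split; first exact: LkT_ge0.
split; [exact: LkTD|by move=> *; exact: LkTZ|exact: LkT_star|move=> a Ca].
by split=> [|[z ->]]; [exact: LkT_eq0|exact: LkT_scalar].
Qed.

End Seminorm.

(** * Comparison of the topologies *)

Section StatePerturbation.
Variables (R : realType) (A : cstarAlgebra R).
Implicit Types (mu nu : {scalar A}) (V : set A).

Lemma state_bound mu nu a : is_state mu -> is_state nu ->
  normc (mu a - nu a) <= 2 * cnorm a.
Proof.
case=> _ mua _ [_ nua _]; apply: le_trans (normcD _ _) _.
rewrite (_ : normc (- nu a) = normc (nu a)); last exact: normcN.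
by rewrite mulr2n mulrDl mul1r; apply: lerD.
Qed.

Lemma normc_subr_sum mu nu (I : Type) (r : seq I) (F : I -> A) :
  normc (mu (\sum_(i <- r) F i) - nu (\sum_(i <- r) F i)) <=
  \sum_(i <- r) normc (mu (F i) - nu (F i)).
Proof.
by rewrite !state_sum -sumrB; exact: normc_sum.
Qed.

Lemma lip_dist_le V (L : A -> R) mu nu (e : R) :
    (forall a, V a -> L a <= 1 -> normc (mu a - nu a) <= e) ->
  (lip_dist V L mu nu <= e%:E)%E.
Proof. by move=> h; apply/ereal_supP => _ [a [Va La] <-]; rewrite lee_fin h. Qed.

(** Rescaling by [L a + 1] instead of [L a] puts the element in the unit ball of [L] even when
    [L a = 0]. *)
Lemma lip_dist_bound V (L : A -> R) mu nu (e : R) a :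
    (forall (z : R[i]) a b, V a -> V b -> V (z *: a + b)) -> V 0 ->
    (forall (z : R[i]) a, V a -> L (z *: a) = normc z * L a) ->
    (forall a, V a -> 0 <= L a) ->
    V a -> (lip_dist V L mu nu < e%:E)%E ->
  normc (mu a - nu a) <= (L a + 1) * e.
Proof.
move=> linV V0 LZ L0 Va mn; have La := L0 _ Va.
have r0 : 0 < L a + 1 by rewrite ltr_wpDl.
have ri0 : 0 <= (L a + 1)^-1 by rewrite invr_ge0 ltW.
have : ((normc (mu ((L a + 1)^-1%:C *: a) - nu ((L a + 1)^-1%:C *: a)))%:E
    <= e%:E)%E.
  apply: le_trans (ltW mn); apply: ereal_sup_ubound.
  exists ((L a + 1)^-1%:C *: a) => //; split.
    by rewrite -[_ *: _]addr0; exact: linV.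
  by rewrite LZ// normc_real ger0_norm// mulrC ler_pdivrMr// mul1r lerDl.
rewrite lee_fin !stateZ -mulrBr normcM normc_real ger0_norm//.
by rewrite mulrC ler_pdivrMr// mulrC.
Qed.

(** Each of the finitely many test elements is replaced by one of [V] at distance less than [e / 4].
    Two states differ by less than [e / 2] on the error, and [lip_dist] controls the rest. *)
Lemma lip_dist_open_of_wstar_open V (L : A -> R) (U : set {scalar A}) :
    dense_star_subalgebra V -> lipschitz_seminorm V L ->
    (forall mu, U mu -> is_state mu) ->
  wstar_open U -> lip_dist_open V L U.
Proof.
move=> [V1 linV _ _ dense] [L0 [_ LZ _ _]] Ust Uopen mu Umu.
have V0 : V 0 by have := linV (-1) 1 1 V1 V1; rewrite scaleN1r addNr.
have [e e0 [F FU]] := Uopen mu Umu.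
have /choice[b bF] : forall a, exists b, V b /\ cnorm (a - b) < e / 4.
  by move=> a; have [|b Vb ab] := dense a (e / 4); [rewrite divr_gt0|exists b].
(* [K] dominates all the factors [L (b a) + 1], so one radius serves every test element; [K + 1] is
   positive even if [F] is empty. *)
pose K := \sum_(a <- F) (L (b a) + 1).
have Lb a : 0 <= L (b a) + 1 by rewrite addr_ge0// L0//; case: (bF a).
have K0 : 0 <= K by rewrite sumr_ge0.
have d0 : 0 < e / 2 / (K + 1) by rewrite !divr_gt0// ltr_wpDl.
exists (e / 2 / (K + 1)) => // nu nust mn; apply: FU => // a aF.
have [Vb ab] := bF a.
have -> : mu a - nu a = (mu (a - b a) - nu (a - b a)) + (mu (b a) - nu (b a)).
  by rewrite !linearB /=; ring.
apply: le_lt_trans (normcD _ _) _.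
have LK : L (b a) + 1 <= K by rewrite /K (big_rem a)//= lerDl sumr_ge0.
have h1 := state_bound (a - b a) (Ust _ Umu) nust.
have h2 := lip_dist_bound linV V0 LZ L0 Vb mn.
have h3 : (L (b a) + 1) * (e / 2 / (K + 1)) <= e / 2.
  rewrite mulrCA -[leRHS]mulr1 ler_pM2l ?divr_gt0// ler_pdivrMr ?ltr_wpDl//.
  by rewrite mul1r ler_wpDr.
by lra.
Qed.

End StatePerturbation.

(** * Uniform tail estimates from property RD, and weak-* neighbourhoods inside [lip_dist] balls *)

Section Tail.
Variables (R : realType) (G : discreteQG R) (l : Irr G -> R) (k : nat).
Variables (L : G -> R) (c s : R).
Hypotheses (hl : word_length_function l) (hk : (0 < k)%N) (hL : is_LkT l k L).
Hypotheses (hc : 0 < c) (hs : 0 < s) (hks : s < k%:R).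
Hypothesis hcs : forall a : G, CG G a ->
  (regular_norm a <= (c * sobolev_norm l s a)%:E)%E.
Implicit Types (a b x y : G) (alpha beta : Irr G).

(** By reducedness [cnorm] is the operator norm in the regular representation, to which the RD
    inequality applies. *)
Lemma cnorm_sobolev a : CG G a -> cnorm a <= c * sobolev_norm l s a.
Proof. by move=> Ca; rewrite -lee_fin haar_isometric; exact: hcs. Qed.

Definition tail (n : nat) a : G :=
  diag_op (fun alpha _ => if n%:R <= l alpha then 1 else 0) a.

Lemma coef_tail n a alpha (i j : 'I_(dim alpha)) : CG G a ->
  coef i j (tail n a) = if n%:R <= l alpha then coef i j a else 0.
Proof.
by move=> Ca; rewrite /tail coef_diag_op//; case: ifP; rewrite ?mul1r ?mul0r.
Qed.

(** For [x >= 1] the left side is at most [(2 x)^s = 2^s x^(s-k) x^k], and [x^(s-k) <= n^(s-k)]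
    because [s < k]. The factor [n^(s-k)] is what makes tails small. *)
Lemma powR_one_add_le (n : nat) (x : R) : (0 < n)%N -> n%:R <= x ->
  (1 + x) `^ s <= 2 `^ s * n%:R `^ (s - k%:R) * x ^+ k.
Proof.
move=> n0 nx; have n0' : 0 < n%:R :> R by rewrite ltr0n.
have x1 : 1 <= x by apply: le_trans nx; rewrite ler1n.
have x0 : 0 < x by apply: lt_le_trans x1.
have -> : x ^+ k = x `^ s * x `^ (k%:R - s).
  rewrite -powRD ?(gt_eqF x0) ?implybT// addrC subrK powR_mulrn//.
  exact: ltW.
apply: (@le_trans _ _ (2 `^ s * x `^ s)).
  rewrite -(@powRM _ 2 x) ?(ltW x0)//; apply: ge0_ler_powR;
    rewrite ?nnegrE ?(ltW hs)//; lra.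
rewrite -mulrA ler_pM2l ?powR_gt0// mulrCA ler_peMr ?powR_ge0//.
rewrite -(opprB k%:R) powRN mulrC ler_pdivlMr ?powR_gt0// mul1r.
by apply: ge0_ler_powR; rewrite ?nnegrE ?subr_ge0 ?(ltW hks) ?(ltW n0') ?(ltW x0).
Qed.

Lemma tail_small (e : R) : 0 < e -> exists n : nat, forall a, CG G a ->
  L a <= 1 -> cnorm (tail n a) <= e.
Proof.
move=> e0; have [t t0 T1] := @Top_one R G k.
have ks : 0 < k%:R - s by rewrite subr_gt0.
(* [B] is the threshold for [n^(k-s)] from which on [c * q <= e], with [q] the Sobolev bound
   below. *)
pose B := c * 2 `^ s / (t ^+ k * e).
have tk : 0 < t ^+ k by rewrite exprn_gt0.
have B0 : 0 < B by rewrite divr_gt0 ?mulr_gt0 ?powR_gt0.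
(* The successor ensures [0 < n], as [powR_one_add_le] requires. *)
pose n := (Num.bound (B `^ (k%:R - s)^-1)).+1.
have nB : B <= n%:R `^ (k%:R - s).
  have -> : B = (B `^ (k%:R - s)^-1) `^ (k%:R - s).
    by rewrite -powRrM mulVf ?gt_eqF// powRr1// ltW.
  apply: ge0_ler_powR; rewrite ?nnegrE ?powR_ge0 ?(ltW ks)//.
  by apply/ltW/(lt_trans (archi_boundP (powR_ge0 _ _))); rewrite ltr_nat.
exists n => a Ca La.
have Ct : CG G (tail n a) by exact: CG_diag_op.
apply: le_trans (cnorm_sobolev Ct) _.
pose q := 2 `^ s * n%:R `^ (s - k%:R) / t ^+ k.
have q0 : 0 <= q by rewrite divr_ge0 ?mulr_ge0 ?powR_ge0 ?ltW.
suff sob : sobolev_norm l s (tail n a) <= q.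
  apply: le_trans (ler_wpM2l (ltW hc) sob) _.
  rewrite /q -(opprB k%:R) powRN !mulrA ler_pdivrMr// ler_pdivrMr ?powR_gt0//.
  rewrite -ler_pdivrMl ?mulr_gt0//; apply: le_trans nB.
  by rewrite /B mulrC [e * _]mulrC.
rewrite -(@ler_pXn2r _ 2) ?nnegrE ?sqrtr_ge0//.
have [A aA] := CG_supported Ca.
have tA : supported_in A (tail n a).
  by split=> // alpha aa i j; rewrite coef_tail// (proj2 aA)// if_same.
have CD : CG G (iter k (delta_T l k) (fun x => a * x) 1).
  by apply: (iter_delta_T_operator _ _ _ (lmul_operator Ca)).1; exact: CG1.
have DA : supported_in A (iter k (delta_T l k) (fun x => a * x) 1).
  split=> // alpha aa i j.
  rewrite (coef_delta_T_one _ _ _ (lmul_operator Ca) (Dop_one hl) T1) mulr1.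
  by rewrite (proj2 aA)// mulr0.
rewrite (sobolev_norm_sqr _ _ tA).
(* Both sides are sums over the same blocks with the same factor [1 / dim alpha], so the weights are
   compared term by term. The norm of [delta_T^k(a) 1] is then at most [L a <= 1]. *)
apply: (@le_trans _ _ (q ^+ 2 *
  l2norm (haar G) (iter k (delta_T l k) (fun x => a * x) 1) ^+ 2)).
  rewrite (l2norm_parseval DA) mulr_sumr; apply: ler_sum => alpha _.
  rewrite mulr_sumr; apply: ler_sum => i _; rewrite mulr_sumr; apply: ler_sum => j _.
  rewrite (coef_Delta_one hl hk _ _ T1 Ca) coef_tail//.
  have d0 : 0 <= normc (coef i j a) ^+ 2 / (dim alpha)%:R.
    by rewrite divr_ge0 ?sqr_ge0.
  case: ifPn => [nl|_]; last first.
    rewrite normc0 expr0n mul0r mulr0.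
    by do 2?[apply: mulr_ge0 => //; first exact: sqr_ge0].
  rewrite mulrA ler_wpM2r// -exprMn ler_pXn2r ?nnegrE ?powR_ge0//.
    rewrite exprMn /q mulrA divfK ?gt_eqF//.
    exact: powR_one_add_le.
  by rewrite mulr_ge0 // exprn_ge0 // mulr_ge0 ?(ltW t0) //; exact: le_trans nl.
rewrite ler_piMr ?sqr_ge0// expr_le1 ?l2norm_ge0//.
have := LkT_bound hL Ca (CG1 G); rewrite (l2norm1 (haar_state G)) mulr1.
by move=> h; exact: le_trans h La.
Qed.

(** A nonzero length is an integer, hence at least 1, so the weight of the coordinate in
    [delta_T^k(a) 1] is bounded below by a power of [t]. Blocks of length 0 are excluded: [L]
    vanishes on scalars. *)
Lemma coef_le_of_LkT : exists2 B : Irr G -> R, (forall alpha, 0 <= B alpha) &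
  forall a alpha (i j : 'I_(dim alpha)), CG G a -> L a <= 1 -> l alpha != 0 ->
    normc (coef i j a) <= B alpha.
Proof.
have [t t0 T1] := @Top_one R G k.
have tk : 0 < t ^+ k by rewrite exprn_gt0.
(* Since [x^2 <= m] implies [x <= m + 1], adding 1 avoids a square root. *)
pose B (alpha : Irr G) : R := (dim alpha)%:R / (t ^+ k) ^+ 2 + 1.
have B1 alpha : 1 <= B alpha by rewrite lerDr divr_ge0// sqr_ge0.
exists B => [alpha|a alpha i j Ca La ln]; first exact: le_trans (B1 _).
have CD : CG G (iter k (delta_T l k) (fun x => a * x) 1).
  by apply: (iter_delta_T_operator _ _ _ (lmul_operator Ca)).1; exact: CG1.
have := coef_le_l2norm i j CD; rewrite (coef_Delta_one hl hk _ _ T1 Ca) => h.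
have D1 : l2norm (haar G) (iter k (delta_T l k) (fun x => a * x) 1) ^+ 2 <= 1.
  rewrite expr_le1 ?l2norm_ge0//; apply: le_trans La.
  by have := LkT_bound hL Ca (CG1 G); rewrite (l2norm1 (haar_state G)) mulr1.
have l1 : 1 <= l alpha.
  have [m lm] := word_length_nat alpha hl; move: ln; rewrite lm pnatr_eq0 ler1n.
  by rewrite lt0n.
have d0 : 0 < (dim alpha)%:R :> R by rewrite ltr0n (leq_ltn_trans _ (ltn_ord i)).
have {D1}h := le_trans h D1; set x := normc _ in h *.
have x0 : 0 <= x by exact: normc_ge0.
have : x ^+ 2 <= (dim alpha)%:R / (t ^+ k) ^+ 2.
  rewrite ler_pdivlMr ?exprn_gt0// mulrC -[leRHS]mul1r -ler_pdivrMr// -mulrA.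
  apply: le_trans h; rewrite ler_wpM2r ?divr_ge0 ?sqr_ge0//.
  rewrite exprMn exprMn ler_peMr ?sqr_ge0//.
  by rewrite !exprn_ege1.
rewrite /B; nra.
Qed.

Lemma wstar_open_of_lip_dist_open (U : set {scalar G}) :
    (forall mu, U mu -> is_state mu) ->
  lip_dist_open (CG G) L U -> wstar_open U.
Proof.
move=> Ust Uopen mu Umu; have must := Ust _ Umu.
have [e e0 eU] := Uopen mu Umu.
(* On the tail two states differ by at most [2 * (e / 8) = e / 4]. With another [e / 4] from the
   ball the total is [e / 2], which keeps the supremum strictly below [e]. *)
have [|n tailn] := @tail_small (e / 8); first by rewrite divr_gt0.
have [B B0 Bcoef] := coef_le_of_LkT.
have := @finite_ball R G l n hl.
set ball := [set alpha | l alpha < n%:R]%classic => fball.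
pose S := fset_set ball.
have inS alpha : (alpha \in S) = (l alpha < n%:R).
  by rewrite in_fset_set//; apply/idP/idP; rewrite inE.
pose K := \sum_(alpha <- S) \sum_(i < dim alpha) \sum_(j < dim alpha) B alpha.
have K0 : 0 <= K.
  by rewrite sumr_ge0// => alpha _; rewrite sumr_ge0// => i _; rewrite sumr_ge0.
pose d := e / 4 / (K + 1).
have d0 : 0 < d by rewrite !divr_gt0// ltr_wpDl.
exists d => //.
(* The test elements are all matrix coefficients of the finite ball of radius [n]. *)
exists (flatten [seq [seq u alpha ij.1 ij.2 |
    ij <- enum {: 'I_(dim alpha) * 'I_(dim alpha)}] | alpha <- S]) => nu nust close.
apply: eU => //; apply: (@le_lt_trans _ _ (e / 2)%:E); last by rewrite lte_fin; lra.
apply: lip_dist_le => a Ca La.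
pose low := \sum_(alpha <- S) \sum_i \sum_j coef i j a *: u alpha i j : G.
have -> : a = low + tail n a.
  apply: coef_inj => // [|alpha i j].
    by apply: CGD; [exact: CG_sum_u|exact: CG_diag_op].
  rewrite linearD /= (coef_sum S (fun alpha i j => coef i j a)) coef_tail// inS.
  by case: ltP; rewrite ?addr0 ?add0r.
have -> : mu (low + tail n a) - nu (low + tail n a) =
    (mu low - nu low) + (mu (tail n a) - nu (tail n a)).
  by rewrite !linearD /=; ring.
apply: le_trans (normcD _ _) _.
have h1 := state_bound (tail n a) must nust.
have h2 := tailn a Ca La.
suff h3 : normc (mu low - nu low) <= e / 4 by lra.
apply: (@le_trans _ _ (K * d)); last first.
  rewrite /d mulrCA -[leRHS]mulr1 ler_pM2l ?divr_gt0// ler_pdivrMr ?ltr_wpDl//.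
  by rewrite mul1r ler_wpDr.
apply: le_trans (normc_subr_sum _ _ _ _) _.
rewrite /K mulr_suml big_seq [leRHS]big_seq; apply: ler_sum => alpha aS.
apply: le_trans (normc_subr_sum _ _ _ _) _; rewrite mulr_suml; apply: ler_sum => i _.
apply: le_trans (normc_subr_sum _ _ _ _) _; rewrite mulr_suml; apply: ler_sum => j _.
rewrite !stateZ -mulrBr normcM.
(* For length 0 the coordinate of [a] is not bounded by [L], but the entries of [u alpha] are 0 or
   1, where all states agree. *)
have [l0|ln] := eqVneq (l alpha) 0.
  rewrite (word_length_eq0 hl l0) mxE.
  have -> : mu (i == j)%:R - nu (i == j)%:R = 0.
    have [[_ _ mu1] [_ _ nu1]] := (must, nust).
    have [mu0 nu0] : mu 0 = 0 :> R[i] /\ nu 0 = 0 :> R[i] by split; exact: linear0.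
    by case: (i == j); rewrite ?mulr1n ?mulr0n ?mu1 ?nu1 ?mu0 ?nu0 subrr.
  by rewrite normc0 mulr0 mulr_ge0// ltW.
rewrite ler_pM ?normc_ge0 ?Bcoef// ltW// close//.
apply/flatten_mapP; exists alpha => //.
by apply/mapP; exists (i, j); rewrite ?mem_enum.
Qed.

End Tail.

Theorem theorem7p4 (R : realType) (G : discreteQG R)
  (hG : finitely_generated G)
  (l : Irr G -> R) (hl : word_length_function l) (hRD : property_RD l)
  (c s : R) (hc : 0 < c) (hs : 0 < s)
  (hcs : forall a : G, CG G a ->
     (regular_norm a <= (c * sobolev_norm l s a)%:E)%E)
  (k : nat) (hk : (0 < k)%N) (hks : s < k%:R)
  (L : G -> R) (hL : is_LkT l k L) :
  compact_quantum_metric_space (CG G) L.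
Proof.
have lip : lipschitz_seminorm (CG G) L by exact: LkT_lipschitz hl hk hL.
split; first exact: CG_dense; split=> // U Ust; split.
  exact: (wstar_open_of_lip_dist_open hl hk hL hc hs hks hcs).
exact: lip_dist_open_of_wstar_open (CG_dense G) lip Ust.
Qed.
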